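(* Let $k\geq1$. There is a constant $C>0$ depending only on $k$ and $q$ such that the following holds. Let $B$ be a Bohr set, let $A_1\subset B$ have density $\alpha_1=\beta(A_1)>0$, and let $A_2,\dots,A_{k+1}\subset B$ all have density at least $\alpha$, where $0<\alpha<e^{-2}$. Then either (1) there exists a Bohr set $B'\subset B$ with $\mathrm{rk}(B')\leq\mathrm{rk}(B)+C\alpha_1^{-1/k}\log(1/\alpha)$, density $\beta(B')\geq\exp(-C\alpha_1^{-1/k}\log(1/\alpha))$ and, for some $x\in B$, $\beta'(A_1+x)\geq 2\alpha_1$; or (2) there are sets $L,S_1,\dots,S_k\subset B$ with $\beta(L)\geq 2^{-k-6}$ and $\beta(S_i)\geq\alpha^{C\alpha_1^{-1/k}}$ for $1\leq i\leq k$ such that \[L\ast S_1\ast\cdots\ast S_k(x)\leq\alpha_1^{-2}A_1\ast A_2\ast\cdots\ast A_{k+1}(x)\quad\text{for all }x\in G.\]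
   Context: Let $q$ be a prime power, $N$ a positive integer, and $G=G_N$ the set of polynomials in $\mathbb{F}_q[t]$ of degree $<N$. For $x=\sum_{i<M}a_it^i\in\mathbb{F}_q((1/t))$ write $\{x\}=\sum_{i<0}a_it^i$; let $\mathbb{T}=\{\sum_{i<0}a_it^i\}$. For finite $\Gamma\subset\mathbb{T}$ and $\kappa:\Gamma\to\mathbb{N}$, the Bohr set $B_\kappa(\Gamma)=\{x\in G:\deg\{x\xi\}<-\kappa(\xi)\ \forall\xi\in\Gamma\}$ has rank $|\Gamma|$ (it is an $\mathbb{F}_q$-subspace of $G$). Sets are identified with indicator functions. For a Bohr set $B$, $\beta(X)=|X\cap B|/|B|$; for a Bohr set $B'$, $\beta'(X)=|X\cap B'|/|B'|$. Convolution is taken over $B$: $f\ast g(x)=\mathbb{E}_{y\in B}f(y)g(x-y)$ for $x\in G$, iterated convolutions being taken successively. *)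

(* Defs.v *)
From HB Require Import structures.
From mathcomp Require Import all_boot all_order all_algebra.
From mathcomp Require Import finmap.
From mathcomp Require Import boolp reals.
From mathcomp.analysis Require Import sequences exp.

Set Implicit Arguments.
Unset Strict Implicit.
Unset Printing Implicit Defensive.

Import Order.TTheory GRing.Theory Num.Theory.

Local Open Scope ring_scope.

Section Laurent.
Variable F : finFieldType.

(* A series \sum_i a_i t^i is given by its coefficients a : int -> F; it lies
   in F((1/t)) when the exponents occurring in it are bounded above. *)
Local Notation series := (int -> F).

(* Frequencies are Laurent series in 1/t, so only the product of a polynomial
   by a series is needed, and each of its coefficients is a finite sum. *)
Definition poly_mul_series (x : {poly F}) (a : series) : series :=
  fun i => \sum_(j < size x) x`_j * a (i - j%:Z).

Definition frac_part (a : series) : series :=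
  fun i => if i < 0 then a i else 0.

Definition in_torus (a : series) : Prop := forall i : int, a i != 0 -> i < 0.

(* deg a < m, with the convention deg 0 = -oo *)
Definition deg_lt (a : series) (m : int) : Prop :=
  forall i : int, a i != 0 -> i < m.

(* The rank of a Bohr set depends on its presentation (Gamma, kappa), so a Bohr
   set is its presentation: the finite map kappa with domain Gamma. *)
Record bohr := Bohr {
  width : {fmap series -> nat};
  width_torus : forall xi : domf width, in_torus (val xi)
}.

Definition rk (b : bohr) : nat := #|` domf (width b)|%fset.

Definition bohr_set (N : nat) (b : bohr) : {set {poly_N F}} :=
  [set x : {poly_N F} | `[< forall xi : domf (width b),
     deg_lt (frac_part (poly_mul_series x (val xi))) (- (width b xi)%:Z) >]].

End Laurent.

Section Densities.
Variables (R : realType) (G : finZmodType).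

Definition density (B X : {set G}) : R := #|X :&: B|%:R / #|B|%:R.

Definition translate (X : {set G}) (x : G) : {set G} := [set a + x | a in X].

Definition indic (X : {set G}) : G -> R := fun x => (x \in X)%:R.

Definition conv (B : {set G}) (f g : G -> R) : G -> R :=
  fun x => (\sum_(y in B) f y * g (x - y)) / #|B|%:R.

(* X * Y_0 * ... * Y_(k-1), bracketed to the left *)
Definition iter_conv (B : {set G}) (k : nat) (X : {set G})
    (Y : 'I_k -> {set G}) : G -> R :=
  foldl (conv B) (indic X) [seq indic (Y i) | i <- enum 'I_k].

End Densities.

Arguments density R {G} B X.
Arguments iter_conv R {G} B {k} X Y.

(* Main.v *)
(** Write [m] for the least integer above [alpha1^(-1/k)] and choose [eps] of order
    [alpha1^(1/(2k))]. By Chang's theorem the frequencies at which some [A i] has a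
    normalised Fourier coefficient above [eps] are trivial on a Bohr set [V] inside [B], of
    codimension [O(alpha1^(-1/k) log(1/alpha))]. If no translate of [A1] has relative
    density [2 alpha1] on [V], the part of the Fourier mass of [A1] that these frequencies
    carry is at most [2 alpha1 |A1|].

    Sample [m]-tuples [X i] with weight the size of [S i], the set of [s] with
    [s + X i] inside [A i]. This amounts to sampling [X i] from a translate of [A i], so away
    from the large spectrum [|X i^|^2] has mean [O(m)], and Parseval gives
    [E |A1 + X 1 + ... + X k| >> |B|] by a second moment computation. With
    [L = A1 + X 1 + ... + X k], each element of [L] arises from at most [m^k <= alpha1^-2]
    translates of [A1], and [S i + X i] lies in [A i], which is the convolution bound.

    Characters are handled through their real and imaginary parts (cosine and sine). *)

Require Import Defs.
From HB Require Import structures.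
From mathcomp Require Import all_boot all_order all_algebra all_field.
From mathcomp Require Import finmap.
From mathcomp Require Import boolp reals.
From mathcomp.analysis Require Import sequences exp trigo.
From mathcomp Require Import ring lra zify.

Set Implicit Arguments.
Unset Strict Implicit.
Unset Printing Implicit Defensive.

Import Order.TTheory GRing.Theory Num.Theory.

Local Open Scope ring_scope.

(** * Characters and Parseval's identity *)

Section RealCharacters.
Variable R : realType.

(* A homomorphism [re + i im] into the unit circle, by real and imaginary parts. *)
Record real_char (G : zmodType) := RealChar {
  re : G -> R;
  im : G -> R;
  reD : forall x y, re (x + y) = re x * re y - im x * im y;
  imD : forall x y, im (x + y) = im x * re y + re x * im y;
  re2_im2 : forall x, re x ^+ 2 + im x ^+ 2 = 1
}.

Lemma re0 (G : zmodType) (chi : real_char G) : re chi 0 = 1.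
Proof.
have hr := reD chi 0 0; have hi := imD chi 0 0; have h1 := re2_im2 chi 0.
rewrite addr0 in hr hi.
have hm : re chi 0 * (re chi 0 - 1) = im chi 0 ^+ 2 by rewrite expr2; lra.
have : im chi 0 * (2 * re chi 0 - 1) = 0 by lra.
move/eqP; rewrite mulf_eq0 => /orP[/eqP h0|/eqP h0]; last first.
  have e : re chi 0 = 2^-1 by lra.
  by rewrite e in hm h1; lra.
rewrite h0 in hm h1.
have : re chi 0 ^+ 2 - re chi 0 = 0 by rewrite expr2; lra.
lra.
Qed.

Lemma im0_of_re1 (G : zmodType) (chi : real_char G) x : re chi x = 1 -> im chi x = 0.
Proof.
move=> h; have := re2_im2 chi x; rewrite h expr1n => h1.
by apply/eqP; rewrite -sqrf_eq0; apply/eqP; lra.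
Qed.

Lemma reD1 (G : zmodType) (chi : real_char G) x y :
  re chi y = 1 -> re chi (x + y) = re chi x.
Proof. by move=> h; rewrite reD h (im0_of_re1 h); lra. Qed.

Lemma imD1 (G : zmodType) (chi : real_char G) x y :
  re chi y = 1 -> im chi (x + y) = im chi x.
Proof. by move=> h; rewrite imD h (im0_of_re1 h); lra. Qed.

Lemma reN (G : zmodType) (chi : real_char G) x : re chi (- x) = re chi x.
Proof.
have hr := reD chi x (- x); have hi := imD chi x (- x).
rewrite subrr in hr hi; rewrite re0 in hr; rewrite (im0_of_re1 (re0 chi)) in hi.
have -> : re chi (- x) = re chi (- x) * (re chi x ^+ 2 + im chi x ^+ 2).
  by rewrite re2_im2 mulr1.
have -> : re chi (- x) * (re chi x ^+ 2 + im chi x ^+ 2) =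
  re chi x * (re chi x * re chi (- x) - im chi x * im chi (- x))
  + im chi x * (im chi x * re chi (- x) + re chi x * im chi (- x)) by ring.
by rewrite -hr -hi; ring.
Qed.

Lemma imN (G : zmodType) (chi : real_char G) x : im chi (- x) = - im chi x.
Proof.
have hr := reD chi x (- x); have hi := imD chi x (- x).
rewrite subrr in hr hi; rewrite re0 in hr; rewrite (im0_of_re1 (re0 chi)) in hi.
have -> : im chi (- x) = im chi (- x) * (re chi x ^+ 2 + im chi x ^+ 2).
  by rewrite re2_im2 mulr1.
have -> : im chi (- x) * (re chi x ^+ 2 + im chi x ^+ 2) =
  re chi x * (im chi x * re chi (- x) + re chi x * im chi (- x))
  - im chi x * (re chi x * re chi (- x) - im chi x * im chi (- x)) by ring.
by rewrite -hr -hi; ring.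
Qed.

Lemma reB (G : zmodType) (chi : real_char G) x y :
  re chi (x - y) = re chi x * re chi y + im chi x * im chi y.
Proof. by rewrite reD reN imN; ring. Qed.

(** Closed by [Defined], so that [re] and [im] of a pulled-back character reduce to those of [chi]
    at [f x]. *)
Definition pull_char (G H : zmodType) (f : G -> H) (fD : {morph f : x y / x + y})
    (chi : real_char H) : real_char G.
Proof.
by exists (re chi \o f) (im chi \o f) => [x y|x y|x] /=;
  rewrite ?fD ?reD ?imD ?re2_im2.
Defined.

Definition zsubgroup (G : finZmodType) (V : {set G}) : Prop :=
  0 \in V /\ forall x y, x \in V -> y \in V -> x - y \in V.

Section Subgroups.
Variables (G : finZmodType) (V : {set G}).
Hypothesis sV : zsubgroup V.

Lemma zsubgroupN x : x \in V -> - x \in V.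
Proof. by case: sV => V0 VB xV; rewrite -sub0r VB. Qed.

Lemma zsubgroupD x y : x \in V -> y \in V -> x + y \in V.
Proof. by case: sV => V0 VB xV yV; rewrite -[y]opprK VB // zsubgroupN. Qed.

Lemma zsubgroupDr x v : v \in V -> (x + v \in V) = (x \in V).
Proof.
move=> vV; apply/idP/idP => [h|h]; last exact: zsubgroupD.
by rewrite -(addrK v x) zsubgroupD // zsubgroupN.
Qed.

Lemma zsubgroup_card_gt0 : (0 < #|V|)%N.
Proof. by apply/card_gt0P; exists 0; case: sV. Qed.

Lemma sum_zsubgroup_shift (f : G -> R) v :
  v \in V -> \sum_(x in V) f (x + v) = \sum_(x in V) f x.
Proof.
move=> vV; rewrite [RHS](reindex_inj (addIr v)) /=.
by apply: eq_bigl => x; rewrite zsubgroupDr.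
Qed.

(** Translation by [v] leaves [P] unchanged and multiplies the complex sum [S = a + i b] by [chi v],
    which differs from 1; hence [S = 0]. *)
Lemma sum_char_eq0 (P : G -> R) (chi : real_char G) v :
  (forall x, P (x + v) = P x) -> v \in V -> re chi v != 1 ->
  \sum_(x in V) P x * re chi x = 0 /\ \sum_(x in V) P x * im chi x = 0.
Proof.
move=> Pv vV nv.
have := sum_zsubgroup_shift (fun x => P x * re chi x) vV.
have := sum_zsubgroup_shift (fun x => P x * im chi x) vV.
set a := \sum_(x in V) P x * re chi x; set b := \sum_(x in V) P x * im chi x => hi hr.
have {}hr : a * re chi v - b * im chi v = a.
  by rewrite -[RHS]hr !mulr_suml -sumrB; apply: eq_bigr => x _; rewrite Pv reD; ring.
have {}hi : b * re chi v + a * im chi v = b.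
  rewrite -[RHS]hi !mulr_suml -big_split /=; apply: eq_bigr => x _.
  by rewrite Pv imD; ring.
have n1 : 1 - re chi v != 0 by rewrite subr_eq0 eq_sym.
(* The right-hand side of the identity below is the real part of [conj S * (S - chi v * S)], so no
   complex division occurs. *)
suff /eqP h : (1 - re chi v) * (a ^+ 2 + b ^+ 2) = 0.
  move: h; rewrite mulf_eq0 (negPf n1) /= paddr_eq0 ?sqr_ge0 // !sqrf_eq0.
  by move=> /andP[/eqP -> /eqP ->].
have -> : (1 - re chi v) * (a ^+ 2 + b ^+ 2) =
  a * (a - (a * re chi v - b * im chi v)) + b * (b - (b * re chi v + a * im chi v)).
  by ring.
by rewrite hr hi; ring.
Qed.

End Subgroups.

(** * Fourier transforms of functions and of tuples *)

Section Fourier.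
Variables (G : finZmodType) (X : finType) (chi : X -> real_char G).
(** Stated for real parts, the form in which [fpowE] brings the characters into Parseval's
    identity. *)
Hypothesis orth : forall x : G, \sum_xi re (chi xi) x = #|X|%:R * (x == 0)%:R.

(* Squared modulus of the (unnormalised) Fourier transform. *)
Definition fpow (f : G -> R) (xi : X) : R :=
  (\sum_x f x * re (chi xi) x) ^+ 2 + (\sum_x f x * im (chi xi) x) ^+ 2.

Definition spow (xs : seq G) (xi : X) : R :=
  (\sum_(x <- xs) re (chi xi) x) ^+ 2 + (\sum_(x <- xs) im (chi xi) x) ^+ 2.

(** The convolution of [h] with the counting measure of [xs]; a list keeps the multiplicities of a
    sampled tuple. *)
Definition shifts (xs : seq G) (h : G -> R) : G -> R :=
  fun y => \sum_(x <- xs) h (y - x).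

Lemma fpow_ge0 f xi : 0 <= fpow f xi.
Proof. by rewrite addr_ge0 // sqr_ge0. Qed.

Lemma spow_ge0 xs xi : 0 <= spow xs xi.
Proof. by rewrite addr_ge0 // sqr_ge0. Qed.

Lemma fpowE f xi : fpow f xi = \sum_x \sum_y f x * f y * re (chi xi) (x - y).
Proof.
rewrite /fpow !expr2 !big_distrlr /= -big_split /=; apply: eq_bigr => x _.
by rewrite -big_split /=; apply: eq_bigr => y _; rewrite reB; ring.
Qed.

Lemma parseval f : \sum_xi fpow f xi = #|X|%:R * \sum_x f x ^+ 2.
Proof.
under eq_bigr do rewrite fpowE.
rewrite exchange_big mulr_sumr /=; apply: eq_bigr => x _.
rewrite exchange_big /= (bigD1 x) //= [X in _ + X]big1 ?addr0.
  rewrite -mulr_sumr orth subrr eqxx /=; ring.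
by move=> y; rewrite eq_sym => nyx; rewrite -mulr_sumr orth subr_eq0 (negPf nyx) !mulr0.
Qed.

(** With [a + i b] and [u + i w] the transforms of [h] and of [xs], the transform of the convolution
    is their product, and squared moduli multiply. *)
Lemma fpow_shifts xs h xi : fpow (shifts xs h) xi = fpow h xi * spow xs xi.
Proof.
have sE g : \sum_x shifts xs h x * g x = \sum_(v <- xs) \sum_x h x * g (x + v).
  rewrite /shifts; under eq_bigr do rewrite mulr_suml.
  rewrite exchange_big /=; apply: eq_bigr => v _.
  by rewrite (reindex_inj (addIr v)) /=; apply: eq_bigr => x _; rewrite addrK.
rewrite /fpow !sE /spow.
set a := \sum_x h x * re _ x; set b := \sum_x h x * im _ x.
set u := \sum_(x <- xs) re _ x; set w := \sum_(x <- xs) im _ x.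
have -> : \sum_(v <- xs) \sum_x h x * re (chi xi) (x + v) = a * u - b * w.
  rewrite /a /b /u /w !mulr_sumr -sumrB; apply: eq_bigr => v _.
  by rewrite !mulr_suml -sumrB; apply: eq_bigr => x _; rewrite reD; ring.
have -> : \sum_(v <- xs) \sum_x h x * im (chi xi) (x + v) = b * u + a * w.
  rewrite /a /b /u /w !mulr_sumr -big_split; apply: eq_bigr => v _ /=.
  by rewrite !mulr_suml -big_split; apply: eq_bigr => x _ /=; rewrite imD; ring.
ring.
Qed.

Lemma sum_shifts xs h : \sum_y shifts xs h y = (size xs)%:R * \sum_y h y.
Proof.
rewrite /shifts exchange_big /= -sum1_size natr_sum mulr_suml; apply: eq_bigr => v _.
by rewrite (reindex_inj (addIr v)) /= mul1r; apply: eq_bigr => x _; rewrite addrK.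
Qed.

Lemma spow_le xs xi : spow xs xi <= (size xs)%:R ^+ 2.
Proof.
have -> : spow xs xi = \sum_(x <- xs) \sum_(y <- xs) re (chi xi) (x - y).
  rewrite /spow !expr2 !big_distrlr /= -big_split /=; apply: eq_bigr => x _.
  by rewrite -big_split /=; apply: eq_bigr => y _; rewrite reB.
rewrite expr2 -natrM -sum1_size big_distrlr /= natr_sum; apply: ler_sum => x _.
rewrite natr_sum; apply: ler_sum => y _; have := re2_im2 (chi xi) (x - y) => h.
have := sqr_ge0 (im (chi xi) (x - y)) => h2.
have : re (chi xi) (x - y) ^+ 2 <= 1 ^+ 2 by rewrite expr1n; lra.
have [/ltW h0|h0] := ltP (re (chi xi) (x - y)) 0; first by move=> _; rewrite (le_trans h0).
by rewrite ler_pXn2r // ?nnegrE.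
Qed.

End Fourier.
End RealCharacters.

(** * Chang's theorem *)

(** Inverting [1 - z <= expR (- z)] gives [expR z <= 1 / (1 - z)], and [(1 + z + 2 z^2) (1 - z) = 1
    + z^2 (1 - 2 z) >= 1]. *)
Lemma expR_le_quadratic (R : realType) (z : R) :
  z <= 2^-1 -> expR z <= 1 + z + 2 * z ^+ 2.
Proof.
move=> hz; have h := expR_ge1Dx (- z).
have h0 : 0 < 1 - z by lra.
have hm : expR z * (1 - z) <= 1.
  by rewrite -[leRHS](expRxMexpNx_1 z) ler_pM2l ?expR_gt0 //.
rewrite -(ler_pM2r h0) (le_trans hm) //.
have -> : (1 + z + 2 * z ^+ 2) * (1 - z) = 1 + z ^+ 2 * (1 - 2 * z) by ring.
by rewrite lerDl mulr_ge0 ?sqr_ge0 //; lra.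
Qed.

Section Chang.
Variables (R : realType) (G H : finZmodType) (X : finType) (l : X -> G -> H).
Hypothesis lD : forall xi, {morph l xi : x y / x + y}.
Variable psi : real_char R H.

Let chi xi : real_char R G := pull_char (lD xi) psi.

Lemma pairing0 xi : l xi 0 = 0.
Proof. by apply: (addrI (l xi 0)); rewrite -lD !addr0. Qed.

Lemma pairingN xi x : l xi (- x) = - l xi x.
Proof. by apply: (addrI (l xi x)); rewrite -lD !subrr pairing0. Qed.

(** The condition is [l xi x = 0], which implies [chi xi x = 1]. For the coefficient pairing it is
    linear over the field, so annihilators in Bohr sets are again Bohr sets ([refine_set]). *)
Definition annihilator (B : {set G}) (s : seq X) : {set G} :=
  [set x in B | all (fun xi => l xi x == 0) s].

Lemma annihilator_subgroup B s : zsubgroup B -> zsubgroup (annihilator B s).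
Proof.
move=> [B0 BB]; split; first by rewrite inE B0; apply/allP => xi _; rewrite pairing0.
move=> x y; rewrite !inE => /andP[xB /allP x0] /andP[yB /allP y0]; rewrite BB //=.
by apply/allP => xi xis; rewrite lD pairingN (eqP (x0 _ xis)) (eqP (y0 _ xis)) subrr.
Qed.

Lemma annihilator_cons B xi s x :
  (x \in annihilator B (xi :: s)) = (x \in annihilator B s) && (l xi x == 0).
Proof. by rewrite !inE /= andbCA andbC. Qed.

(** The map [l xi] cuts the annihilator of [s] into at most [#|H|] fibres, and subtracting a point
    of a fibre carries it into the smaller annihilator. *)
Lemma card_annihilator_cons B xi s : zsubgroup B ->
  (#|annihilator B s| <= #|H| * #|annihilator B (xi :: s)|)%N.
Proof.
move=> sB; have sV := annihilator_subgroup s sB.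
set V := annihilator B s; set W := annihilator B (xi :: s).
rewrite -sum1_card (partition_big (l xi) predT) //= -sum_nat_const.
apply: leq_sum => h _; rewrite sum1dep_card.
have [->|[x0]] := set_0Vmem [set x | (x \in V) && (l xi x == h)]; first by rewrite cards0.
rewrite inE => /andP[x0V /eqP x0h].
rewrite -(card_imset _ (addIr (- x0))) subset_leq_card //.
apply/subsetP => _ /imsetP[x + ->]; rewrite inE => /andP[xV /eqP xh].
by rewrite annihilator_cons lD pairingN xh x0h subrr eqxx andbT; apply: sV.2.
Qed.

Lemma card_annihilator B s : zsubgroup B ->
  (#|B| <= #|H| ^ size s * #|annihilator B s|)%N.
Proof.
move=> sB; elim: s => [|xi s IH].
  by rewrite expn0 mul1n subset_leq_card //; apply/subsetP => x xB; rewrite inE xB.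
apply: (leq_trans IH); rewrite /= expnS [(#|H| * _)%N]mulnC -mulnA leq_mul2l.
by rewrite card_annihilator_cons ?orbT.
Qed.

(* Each new frequency is non-trivial on the annihilator of the previous ones; over [H] this
   plays the part of dissociativity in Chang's theorem. *)
Fixpoint independent_chain (B : {set G}) (S : pred X) (s : seq X) : Prop :=
  if s is xi :: s' then
    [/\ independent_chain B S s', S xi &
        exists2 v, v \in annihilator B s' & re (chi xi) v != 1]
  else True.

Lemma trivial_on_kernel xi v : l xi v = 0 -> re (chi xi) v = 1.
Proof. by rewrite /= => ->; exact: re0. Qed.

(** A Riesz product. The factors of the tail are invariant under the witness [v] of the head [xi],
    so by [sum_char_eq0] the head contributes only its constant term [p]. *)
Lemma independent_chain_product B S s (a b : X -> R) (p t : R) :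
  zsubgroup B -> independent_chain B S s ->
  \sum_(x in B) \prod_(xi <- s) (p + t * (a xi * re (chi xi) x + b xi * im (chi xi) x))
  = #|B|%:R * p ^+ size s.
Proof.
move=> sB; elim: s => [_|xi s IH [cs _ [v vV nv]]].
  under eq_bigr do rewrite big_nil.
  by rewrite sumr_const expr0 mulr1.
pose P x := \prod_(xi <- s) (p + t * (a xi * re (chi xi) x + b xi * im (chi xi) x)).
have vB : v \in B by move: vV; rewrite inE => /andP[].
have Pv x : P (x + v) = P x.
  rewrite /P; apply: eq_big_seq => eta etas.
  move: vV; rewrite inE => /andP[_ /allP /(_ _ etas) /eqP /trivial_on_kernel e1].
  by rewrite reD1 // imD1.
have [h1 h2] := sum_char_eq0 sB Pv vB nv.
transitivity (p * (\sum_(x in B) P x) + t * (a xi * \sum_(x in B) P x * re (chi xi) x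
   + b xi * \sum_(x in B) P x * im (chi xi) x)).
  rewrite !mulr_sumr -big_split /= mulr_sumr -big_split /=.
  by apply: eq_bigr => x _; rewrite big_cons -/(P x); ring.
by rewrite h1 h2 IH // exprS; ring.
Qed.

Lemma unit_combination_le1 (u v c d : R) : u ^+ 2 + v ^+ 2 = 1 ->
  c ^+ 2 + d ^+ 2 = 1 -> -1 <= u * c + v * d <= 1.
Proof.
move=> h1 h2; have k1 := sqr_ge0 (u - c); have k2 := sqr_ge0 (v - d).
have k3 := sqr_ge0 (u + c); have k4 := sqr_ge0 (v + d).
by apply/andP; split; rewrite !expr2 in h1 h2 k1 k2 k3 k4; lra.
Qed.

(** Exponential moments: on [A] the sum of the aligned characters has mean at least [eps * size s],
    while the Riesz product bounds its exponential moment over the whole of [B]. *)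
Lemma chang_bound (B A : {set G}) s (eps alpha : R) :
  zsubgroup B -> A \subset B -> 0 < alpha -> alpha * #|B|%:R <= #|A|%:R ->
  0 < eps <= 1 ->
  independent_chain B (fun xi => (eps * #|A|%:R) ^+ 2 < spow chi (enum A) xi) s ->
  (size s)%:R * eps ^+ 2 <= 8 * ln (alpha^-1).
Proof.
move=> sB sAB a0 aA /andP[e0 e1] cs; set S := (fun xi => _) in cs.
have B0 : 0 < #|B|%:R :> R by rewrite ltr0n zsubgroup_card_gt0.
have A0 : 0 < #|A|%:R :> R by apply: lt_le_trans aA; rewrite mulr_gt0.
pose n xi := Num.sqrt (spow chi (enum A) xi).
(* The vector [(a, b)] is the direction of the character sum over [A], so [y xi] is the character
   rotated to have the real sum [n xi] over [A]. *)
pose a xi := (\sum_(x <- enum A) re (chi xi) x) / n xi.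
pose b xi := (\sum_(x <- enum A) im (chi xi) x) / n xi.
pose y xi x := a xi * re (chi xi) x + b xi * im (chi xi) x.
have Ss : all S s by elim: s cs => //= xi s IH [/IH -> -> _].
have n0 xi : S xi -> 0 < n xi.
  by move=> h; rewrite sqrtr_gt0 (le_lt_trans _ h) // sqr_ge0.
have y1 xi x : S xi -> -1 <= y xi x <= 1.
  move=> h; apply: unit_combination_le1 (re2_im2 _ _).
  rewrite /a /b !expr_div_n -mulrDl -/(spow chi (enum A) xi) sqr_sqrtr ?spow_ge0 //.
  by rewrite divff // gt_eqF // (le_lt_trans _ h) // sqr_ge0.
have yA xi : S xi -> eps * #|A|%:R <= \sum_(x in A) y xi x.
  move=> h; rewrite -big_enum /= big_split /= -!mulr_sumr.
  have -> : a xi * (\sum_(x <- enum A) re (chi xi) x) +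
            b xi * (\sum_(x <- enum A) im (chi xi) x) = n xi.
    rewrite /a /b ![_ / _ * _]mulrAC -mulrDl -!expr2.
    rewrite -[X in X / _]/(spow chi (enum A) xi).
    rewrite -[X in X / _]sqr_sqrtr ?spow_ge0 // -/(n xi) expr2 mulfK //.
    by rewrite gt_eqF // n0.
  rewrite -(ger0_norm (ltW (mulr_gt0 e0 A0))) -sqrtr_sqr.
  by rewrite ler_wsqrtr // ltW.
(* This value maximises [lam * eps - 2 * lam ^+ 2]; the maximum [eps ^+ 2 / 8] produces the constant
   8. *)
have [lam lamE] : exists lam, lam = eps / 4 by exists (eps / 4).
pose d := (size s)%:R : R; pose T := lam * eps * d.
have lam0 : 0 < lam by rewrite lamE divr_gt0.
have up x : expR (lam * \sum_(xi <- s) y xi x) <=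
   \prod_(xi <- s) (1 + 2 * lam ^+ 2 + lam * y xi x).
  rewrite mulr_sumr expR_sum big_seq [leRHS]big_seq; apply: ler_prod => xi xis.
  have /andP[l1 l2] := y1 xi x (allP Ss _ xis).
  rewrite expR_ge0 /=; apply: (le_trans (expR_le_quadratic _)).
    have : lam * y xi x <= lam * 1 by rewrite ler_pM2l.
    lra.
  rewrite addrAC lerD2r lerD2l exprMn ler_pM2l // ler_piMr ?sqr_ge0 //.
  by rewrite expr2; nra.
(* Jensen's inequality, by the tangent to [expR] at [T], a lower bound for the mean of the exponent
   over [A]. *)
have low : expR T * #|A|%:R <= \sum_(x in A) expR (lam * \sum_(xi <- s) y xi x).
  apply: (@le_trans _ _ (\sum_(x in A) expR T * (1 + (lam * (\sum_(xi <- s) y xi x) - T)))).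
    rewrite -mulr_sumr ler_pM2l ?expR_gt0 // big_split /= sumr_const sumrB sumr_const.
    rewrite lerDl subr_ge0 -mulr_sumr exchange_big /= -mulr_natr /T -!mulrA ler_pM2l //.
    rewrite mulrCA /d -sum1_size natr_sum mulr_suml.
    apply: (@le_trans _ _ (\sum_(xi <- s) eps * #|A|%:R)).
      by apply: ler_sum => xi _; rewrite mul1r.
    by rewrite big_seq [leRHS]big_seq; apply: ler_sum => xi xis; apply/yA/(allP Ss).
  apply: ler_sum => x _; set z := lam * _.
  have -> : expR z = expR T * expR (z - T) by rewrite -expRD; congr expR; ring.
  by rewrite ler_pM2l ?expR_gt0 // expR_ge1Dx.
have key : expR T * #|A|%:R <= #|B|%:R * expR (2 * lam ^+ 2 * d).
  apply: (le_trans low).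
  (* The sum is extended from [A] to [B] while its terms are exponentials, hence nonnegative; then
     each is replaced by its Riesz product. *)
  apply: (@le_trans _ _ (\sum_(x in B) \prod_(xi <- s) (1 + 2 * lam ^+ 2 + lam * y xi x))).
    apply: (@le_trans _ _ (\sum_(x in B) expR (lam * \sum_(xi <- s) y xi x))).
      rewrite [leRHS](big_setID A) /= (setIidPr sAB) lerDl sumr_ge0 // => x _.
      exact: expR_ge0.
    by apply: ler_sum => x _; exact: up.
  rewrite (independent_chain_product a b _ _ sB cs) ler_pM2l // expRM_natr.
  by rewrite lerXn2r ?nnegrE ?expR_ge0 ?expR_ge1Dx // addr_ge0 // mulr_ge0 // sqr_ge0.
have k2 : expR T * alpha <= expR (2 * lam ^+ 2 * d).
  rewrite -(ler_pM2l B0) (le_trans _ key) // mulrCA ler_pM2l ?expR_gt0 //.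
  by rewrite mulrC.
have : T <= 2 * lam ^+ 2 * d + ln (alpha^-1).
  rewrite -ler_expR expRD lnK ?posrE ?invr_gt0 // ler_pdivlMr //.
rewrite /T lamE; lra.
Qed.

(** Greedy choice: a further non-trivial frequency removes its witness [v] from the annihilator, so
    the size of the annihilator strictly drops. *)
Lemma exists_maximal_chain (B : {set G}) (S : pred X) : zsubgroup B ->
  exists2 s, independent_chain B S s &
    forall xi v, S xi -> v \in annihilator B s -> re (chi xi) v = 1.
Proof.
move=> sB.
suff h n s : (#|annihilator B s| <= n)%N -> independent_chain B S s ->
   exists2 s, independent_chain B S s &
    forall xi v, S xi -> v \in annihilator B s -> re (chi xi) v = 1.
  exact: (h #|annihilator B [::]| [::]).
elim: n s => [|n IH] s hn cs.
  by move: hn; rewrite leqNgt zsubgroup_card_gt0 //; exact: annihilator_subgroup.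
have [/existsP[xi /andP[Sxi /existsP[v /andP[vV nv]]]]|hno] :=
  boolP [exists xi, S xi && [exists v in annihilator B s, re (chi xi) v != 1]].
  apply: (IH (xi :: s)); last by split=> //; exists v.
  rewrite -ltnS (leq_trans _ hn) // proper_card //; apply/properP; split.
    by apply/subsetP => x; rewrite annihilator_cons => /andP[].
  exists v => //; rewrite annihilator_cons vV /=.
  by apply: contra nv => /eqP /trivial_on_kernel ->.
exists s => // xi v Sxi vV; apply/eqP; apply: contraNT hno => nv.
by apply/existsP; exists xi; rewrite Sxi; apply/existsP; exists v; rewrite vV.
Qed.

End Chang.

(** * Weighted sampling *)

Section WeightedSelection.
Variables (R : realType) (k : nat) (T : finType) (w : 'I_k -> T -> R).
Hypothesis w_ge0 : forall i x, 0 <= w i x.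
Let Z i := \sum_x w i x.
Hypothesis Z_gt0 : forall i, 0 < Z i.

Let W (f : {ffun 'I_k -> T}) := \prod_i w i (f i).

Lemma sum_ffun_prod (g : 'I_k -> T -> R) :
  \sum_(f : {ffun 'I_k -> T}) \prod_i g i (f i) = \prod_i \sum_x g i x.
Proof. by rewrite bigA_distr_bigA. Qed.

(** The weight [w i (f i)] cancels, and coordinate [i] contributes [c] times the size of the support
    of [w i]; off the support [w / w] is 0, as division by 0 gives 0. *)
Lemma sum_weight_ratio i (c : R) : 0 <= c ->
  c * #|[set x | w i x != 0]|%:R <= Z i ->
  \sum_f W f * (c / w i (f i)) <= \prod_l Z l.
Proof.
move=> c0 hc.
have -> : \sum_f W f * (c / w i (f i)) =
  \sum_(f : {ffun 'I_k -> T}) \prod_l (if l == i then c * (w l (f l) / w l (f l)) else w l (f l)).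
  apply: eq_bigr => f _; rewrite /W (bigD1 i) //= [RHS](bigD1 i) //= eqxx.
  rewrite [X in _ = _ * X](eq_bigr (fun l => w l (f l))); first by ring.
  by move=> l /negPf ->.
rewrite (sum_ffun_prod (fun l x => if l == i then c * (w l x / w l x) else w l x)).
rewrite (bigD1 i) //= [leRHS](bigD1 i) //= eqxx.
rewrite [X in _ * X <= _](eq_bigr Z) => [|l /negPf -> //].
rewrite ler_wpM2r //; first by apply: prodr_ge0 => l _; apply: ltW.
apply: le_trans hc; rewrite -mulr_sumr ler_wpM2l //.
rewrite -sum1_card natr_sum [leRHS]big_mkcond /=; apply: ler_sum => x _.
by rewrite inE; case: eqP => [->|/eqP h] /=; rewrite ?mul0r ?divff.
Qed.

(* Under the product weight, [Q / M + k^-1 * \sum_i c i / w i] has mean at most 2. *)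
Lemma weighted_selection (Q : {ffun 'I_k -> T} -> R) (M : R) (c : 'I_k -> R) :
  (0 < k)%N -> (forall f, 0 <= Q f) -> 0 < M -> (forall i, 0 <= c i) ->
  \sum_f W f * Q f <= M * \prod_i Z i ->
  (forall i, c i * #|[set x | w i x != 0]|%:R <= Z i) ->
  exists f, Q f <= 2 * M /\ forall i, 0 < w i (f i) /\ c i <= 2 * k%:R * w i (f i).
Proof.
move=> k0 Q0 M0 c0 hQ hc.
have kR : 0 < k%:R :> R by rewrite ltr0n.
pose D f := W f * (2 - Q f / M) - k%:R^-1 * \sum_i W f * (c i / w i (f i)).
have W0 f : 0 <= W f by apply: prodr_ge0.
have sW : \sum_f W f = \prod_i Z i by exact: sum_ffun_prod.
have PZ : 0 < \prod_i Z i by apply: prodr_gt0.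
have sD : 0 <= \sum_f D f.
  rewrite sumrB -mulr_sumr exchange_big /=.
  have h1 : \sum_i \sum_f W f * (c i / w i (f i)) <= k%:R * \prod_i Z i.
    apply: (@le_trans _ _ (\sum_(i < k) \prod_l Z l)).
      by apply: ler_sum => i _; exact: sum_weight_ratio.
    by rewrite sumr_const card_ord mulr_natl.
  have h2 : \sum_f W f * (2 - Q f / M) = 2 * \prod_i Z i - (\sum_f W f * Q f) / M.
    rewrite -sW mulr_sumr mulr_suml -sumrB; apply: eq_bigr => f _; ring.
  rewrite h2; have h3 : (\sum_f W f * Q f) / M <= \prod_i Z i.
    by rewrite ler_pdivrMr // mulrC.
  have h4 : k%:R^-1 * \sum_i \sum_f W f * (c i / w i (f i)) <= \prod_i Z i.
    by rewrite ler_pdivrMl.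
  lra.
(* The chosen point must have positive weight. Where [W f = 0] also [D f = 0], so if [D] were
   negative wherever [W] is positive, its sum would be negative. *)
have [f Wf Df] : exists2 f, 0 < W f & 0 <= D f.
  apply: contrapT => hno.
  have hn f : 0 < W f -> D f < 0.
    by move=> h; rewrite ltNge; apply/negP => h2; apply: hno; exists f.
  have D0 f : D f <= 0.
    have [/hn /ltW //|hW] := ltP 0 (W f).
    have e : W f = 0 by apply/eqP; rewrite eq_le hW W0.
    by rewrite /D e mul0r big1 ?mulr0 ?subrr // => i _; rewrite mul0r.
  have [f0 Wf0] : exists f0, 0 < W f0.
    apply: contrapT => hz; move: PZ; rewrite -sW ltNge => /negP; apply.
    apply: sumr_le0 => f _; rewrite leNgt; apply/negP => h; apply: hz; by exists f.
  move: sD; rewrite leNgt => /negP; apply.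
  rewrite (bigD1 f0) //= ltr_wnDr ?hn //.
  by apply: sumr_le0.
exists f.
have wf i : 0 < w i (f i).
  rewrite lt_def w_ge0 andbT; apply: contraTneq Wf => e.
  by rewrite /W (bigD1 i) //= e mul0r ltxx.
have cw i : 0 <= c i / w i (f i) by rewrite divr_ge0.
move: Df; rewrite /D -mulr_sumr mulrCA -mulrBr pmulr_rge0 // => Df.
have S0 : 0 <= \sum_i c i / w i (f i) by apply: sumr_ge0.
have QM : 0 <= Q f / M by rewrite divr_ge0 // ltW.
have kS : 0 <= k%:R^-1 * \sum_i c i / w i (f i) by rewrite mulr_ge0 // invr_ge0 ltW.
split; first by rewrite -ler_pdivrMr //; lra.
move=> i; split=> //.
have h : c i / w i (f i) <= \sum_i c i / w i (f i).
  by rewrite (bigD1 i) //= lerDl sumr_ge0.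
have : k%:R^-1 * (c i / w i (f i)) <= 2.
  have : k%:R^-1 * (c i / w i (f i)) <= k%:R^-1 * \sum_i c i / w i (f i).
    by rewrite ler_pM2l // invr_gt0.
  lra.
by rewrite mulrA ler_pdivrMr // ler_pdivrMl // mulrA [k%:R * 2]mulrC.
Qed.

End WeightedSelection.

(** * Tuples weighted by their common shifts *)

Section Sampling.
Variables (R : realType) (G : finZmodType) (B : {set G}) (m : nat).
Hypothesis sB : zsubgroup B.

Definition common_shift (A : {set G}) (x : {ffun 'I_m -> G}) : {set G} :=
  [set s in B | [forall j, s + x j \in A]].

(** Substitute [a j = s + x j] for each [s] in [B]: weighting [x] by its number of common shifts
    amounts to drawing the entries independently from [A], up to a translation that [phi]
    ignores. *)
Lemma common_shift_card (A : {set G}) (phi : {ffun 'I_m -> G} -> R) :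
  (forall (x : {ffun 'I_m -> G}) s, phi [ffun j => x j - s] = phi x) ->
  \sum_x #|common_shift A x|%:R * phi x
  = #|B|%:R * \sum_(a : {ffun 'I_m -> G}) (\prod_j (a j \in A)%:R) * phi a.
Proof.
move=> hphi.
have cE x : #|common_shift A x|%:R = \sum_(s in B) \prod_j (s + x j \in A)%:R :> R.
  rewrite -sum1_card natr_sum big_mkcond [RHS]big_mkcond /=; apply: eq_bigr => s _.
  rewrite inE; case: (s \in B) => //=; case: forallP => [h|h].
    by rewrite big1 // => j _; rewrite h.
  have /existsP[j hj] : [exists j, s + x j \notin A].
    by rewrite -negb_forall; apply/forallP.
  by rewrite (bigD1 j) //= (negPf hj) mul0r.
under eq_bigr do rewrite cE mulr_suml.
rewrite exchange_big /= -sum1_card natr_sum mulr_suml; apply: eq_bigr => s _.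
rewrite mul1r (reindex_inj (h := fun a : {ffun 'I_m -> G} => [ffun j => a j - s])) /=.
  apply: eq_bigr => a _; rewrite hphi; congr (_ * _); apply: eq_bigr => j _.
  by rewrite ffunE addrC subrK.
move=> a b /ffunP h; apply/ffunP => j; move: (h j); rewrite !ffunE; exact: addIr.
Qed.

Lemma sum_ffun_const (h : G -> R) :
  \sum_(a : {ffun 'I_m -> G}) \prod_j h (a j) = (\sum_x h x) ^+ m.
Proof.
rewrite -(bigA_distr_bigA (fun _ : 'I_m => h)) /=.
by rewrite prodr_const card_ord.
Qed.

(** Distinct coordinates are independent; the square on the left avoids the exponent [m - 2]. *)
Lemma sum_ffun_two (h f g : G -> R) j j' : j != j' ->
  (\sum_x h x) ^+ 2 * \sum_(a : {ffun 'I_m -> G}) (\prod_l h (a l)) * (f (a j) * g (a j'))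
  = (\sum_x h x) ^+ m * ((\sum_x h x * f x) * (\sum_x h x * g x)).
Proof.
move=> njj; have nj' : j' != j by rewrite eq_sym.
pose u (l : 'I_m) x := if l == j then h x * f x else if l == j' then h x * g x else h x.
have -> : \sum_(a : {ffun 'I_m -> G}) (\prod_l h (a l)) * (f (a j) * g (a j'))
    = \sum_(a : {ffun 'I_m -> G}) \prod_l u l (a l).
  apply: eq_bigr => a _; rewrite (bigD1 j) //= (bigD1 j') //=.
  rewrite [RHS](bigD1 j) //= [in RHS](bigD1 j') //= /u !eqxx (negPf nj').
  rewrite [X in _ = _ * (_ * X)](eq_bigr (fun l => h (a l))); first by ring.
  by move=> l /andP[/negPf -> /negPf ->].
rewrite -bigA_distr_bigA /= (bigD1 j) //= (bigD1 j') //=.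
have -> : \prod_(l | (l != j) && (l != j')) \sum_x u l x
    = \prod_(l | (l != j) && (l != j')) \sum_x h x.
  apply: eq_bigr => l /andP[/negPf e /negPf e'].
  by apply: eq_bigr => x _; rewrite /u e e'.
rewrite /u !eqxx (negPf nj').
rewrite -[m in RHS]card_ord -prodr_const [in RHS](bigD1 j) //= [in RHS](bigD1 j') //=.
ring.
Qed.

Lemma sum_common_shift (A : {set G}) :
  \sum_x #|common_shift A x|%:R = #|B|%:R * #|A|%:R ^+ m :> R.
Proof.
have := @common_shift_card A (fun=> 1) (fun _ _ => erefl).
under eq_bigr do rewrite mulr1.
under [X in _ * X]eq_bigr do rewrite mulr1.
move=> ->; rewrite (sum_ffun_const (fun x => (x \in A)%:R)).
by rewrite -natr_sum -big_mkcond sum1_card.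
Qed.

Section SecondMoment.
Variables (X : finType) (chi : X -> real_char R G).

Lemma spow_codomE (x : {ffun 'I_m -> G}) xi :
  spow chi (codom x) xi = \sum_j \sum_j' re (chi xi) (x j - x j').
Proof.
rewrite /spow !big_image /= !expr2 !big_distrlr /= -big_split /=.
by apply: eq_bigr => j _; rewrite -big_split /=; apply: eq_bigr => l _; rewrite reB.
Qed.

(** The [m] diagonal pairs contribute 1 each. An off-diagonal pair has mean
    [spow chi (enum A) xi / #|A|^2 <= d], so together these add at most [d * m^2 <= m / 2]. *)
Lemma sum_common_shift_spow_le (A : {set G}) (d : R) xi :
  0 <= d -> d * m%:R <= 2^-1 -> spow chi (enum A) xi <= d * #|A|%:R ^+ 2 ->
  \sum_x #|common_shift A x|%:R * spow chi (codom x) xi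
  <= #|B|%:R * #|A|%:R ^+ m * (3 / 2 * m%:R).
Proof.
move=> d0 dm hA.
have [A0|A0] := posnP #|A|.
  rewrite A0 big1 => [|x _]; first by rewrite ?(mulr_ge0, exprn_ge0, invr_ge0).
  have [j _|noj] := pickP (predT : pred 'I_m); last first.
    by rewrite spow_codomE big1 ?mulr0 // => j; have := noj j.
  rewrite (_ : common_shift A x = set0) ?cards0 ?mul0r //.
  apply/setP => s; rewrite !inE; apply/negP => /andP[_ /forallP /(_ j)].
  by rewrite (cards0_eq A0) inE.
rewrite common_shift_card; last first.
  move=> x s; rewrite !spow_codomE; apply: eq_bigr => j _; apply: eq_bigr => l _.
  by rewrite !ffunE opprD addrACA subrr addr0.
rewrite -mulrA ler_wpM2l //.
have AR : 0 < #|A|%:R :> R by rewrite ltr0n.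
pose h x : R := (x \in A)%:R.
have hE : \sum_x h x = #|A|%:R by rewrite -natr_sum -big_mkcond sum1_card.
have hf f : \sum_x h x * f x = \sum_(x <- enum A) f x.
  rewrite big_enum /= [RHS]big_mkcond; apply: eq_bigr => x _; rewrite /h.
  by case: (x \in A); rewrite ?mul1r ?mul0r.
under eq_bigr do rewrite spow_codomE mulr_sumr.
rewrite exchange_big /=.
under eq_bigr do under eq_bigr do rewrite mulr_sumr.
under eq_bigr do rewrite exchange_big /=.
rewrite -(ler_pM2l (exprn_gt0 2 AR)) mulr_sumr.
apply: (@le_trans _ _ (\sum_(j < m) (#|A|%:R ^+ 2 * #|A|%:R ^+ m * (1 + m%:R * d)))).
  apply: ler_sum => j _; rewrite mulr_sumr (bigD1 j) //= mulrDr mulr1 lerD //.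
    rewrite ler_pM2l ?exprn_gt0 //.
    under eq_bigr do rewrite subrr re0 mulr1.
    by rewrite (sum_ffun_const h) hE.
  apply: (@le_trans _ _ (\sum_(i < m | i != j) #|A|%:R ^+ m * spow chi (enum A) xi)).
    apply: ler_sum => l nlj.
    under eq_bigr do rewrite reB mulrDr.
    rewrite big_split mulrDr -hE.
    rewrite !(sum_ffun_two h) 1?eq_sym // !hf -!expr2 -mulrDr hE.
    by [].
  apply: (@le_trans _ _ (\sum_(i < m) #|A|%:R ^+ m * spow chi (enum A) xi)).
    rewrite big_mkcond /=; apply: ler_sum => l _; case: ifP => // _.
    by rewrite mulr_ge0 ?spow_ge0 ?exprn_ge0.
  rewrite sumr_const card_ord -[leLHS]mulr_natl.
  rewrite [leRHS](_ : _ = m%:R * (#|A|%:R ^+ m * (d * #|A|%:R ^+ 2))); last by ring.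
  by rewrite ler_wpM2l // ler_wpM2l // exprn_ge0.
rewrite sumr_const card_ord -[leLHS]mulr_natl.
have P0 : 0 <= #|A|%:R ^+ 2 * #|A|%:R ^+ m :> R by rewrite mulr_ge0 // exprn_ge0.
rewrite [leRHS](_ : _ = m%:R * (#|A|%:R ^+ 2 * #|A|%:R ^+ m * (3 / 2))); last by ring.
by rewrite ler_wpM2l // ler_wpM2l // mulrC; lra.
Qed.

End SecondMoment.
End Sampling.

(** * Convolutions and the second moment *)

Section Layers.
Variables (R : realType) (G : finZmodType) (I : eqType) (v : I -> seq G).

(** For [h] the indicator of [A1] this counts the representations of a point in the sumset of [A1]
    and the tuples [v i]. *)
Definition layers (s : seq I) (h : G -> R) : G -> R :=
  foldr (fun i g => shifts (v i) g) h s.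

Lemma fpow_layers (X : finType) (chi : X -> real_char R G) s h xi :
  fpow chi (layers s h) xi = fpow chi h xi * \prod_(i <- s) spow chi (v i) xi.
Proof.
elim: s => [|i s IH] /=; first by rewrite big_nil mulr1.
by rewrite fpow_shifts IH big_cons; ring.
Qed.

Lemma sum_layers m s h : (forall i, size (v i) = m) ->
  \sum_y layers s h y = m%:R ^+ size s * \sum_y h y.
Proof.
move=> sz; elim: s => [|i s IH] /=; first by rewrite mul1r.
by rewrite sum_shifts IH sz exprS mulrA.
Qed.

(** Integrality makes nonzero values at least 1, so the representation count dominates the indicator
    of its support. *)
Lemma layers_nat s h y : (forall z, h z \is a Num.nat) -> layers s h y \is a Num.nat.
Proof.
move=> hh; elim: s y => [|i s IH] y //=.
by rewrite /shifts rpred_sum // => z _; apply: IH.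
Qed.

Lemma layers_eq0 (B : {set G}) s h y : zsubgroup B ->
  (forall i x, x \in v i -> x \in B) -> (forall z, z \notin B -> h z = 0) ->
  y \notin B -> layers s h y = 0.
Proof.
move=> sB vB h0; elim: s y => [|i s IH] y yB //=; first exact: h0.
rewrite /shifts big_seq big1 // => x xi; apply: IH.
by apply: contra yB; rewrite -(zsubgroupDr sB _ (vB _ _ xi)) subrK.
Qed.

Section Convolution.
Variable B : {set G}.
Hypothesis sB : zsubgroup B.

Lemma ler_conv (f g h : G -> R) y :
  (forall z, f z <= g z) -> (forall z, 0 <= h z) -> conv B f h y <= conv B g h y.
Proof.
move=> fg h0; rewrite /conv ler_wpM2r ?invr_ge0 //.
by apply: ler_sum => z _; rewrite ler_wpM2r.
Qed.

Lemma conv_ge0 (f g : G -> R) y :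
  (forall z, 0 <= f z) -> (forall z, 0 <= g z) -> 0 <= conv B f g y.
Proof.
move=> f0 g0; rewrite /conv divr_ge0 //.
by apply: sumr_ge0 => z _; rewrite mulr_ge0.
Qed.

Lemma conv_shifts xs (f g : G -> R) y : (forall x, x \in xs -> x \in B) ->
  conv B (shifts xs f) g y = shifts xs (conv B f g) y.
Proof.
move=> xB; rewrite /conv /shifts -mulr_suml; congr (_ / _).
under eq_bigr do rewrite mulr_suml.
rewrite exchange_big /= big_seq [RHS]big_seq; apply: eq_bigr => x xxs.
rewrite -(sum_zsubgroup_shift sB _ (xB _ xxs)); apply: eq_bigr => z _.
by rewrite addrK opprD addrA addrAC.
Qed.

Lemma conv_layers s (h g : G -> R) y : (forall i x, x \in v i -> x \in B) ->
  conv B (layers s h) g y = layers s (conv B h g) y.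
Proof.
move=> vB; elim: s y => [|i s IH] y //=.
rewrite conv_shifts; last exact: vB.
by rewrite /shifts; apply: eq_bigr => x _; rewrite IH.
Qed.

(** A shift by [x] passes through the convolution to the second factor, where [g] shifted by [x] is
    at most [g']. *)
Lemma conv_shifts_le xs (f g g' : G -> R) y : (forall x, x \in xs -> x \in B) ->
  (forall z, 0 <= f z) -> (forall x z, x \in xs -> g z <= g' (z + x)) ->
  conv B (shifts xs f) g y <= (size xs)%:R * conv B f g' y.
Proof.
move=> xB f0 gg; rewrite conv_shifts // /shifts.
rewrite -sum1_size natr_sum mulr_suml big_seq [leRHS]big_seq; apply: ler_sum => x xxs.
rewrite mul1r /conv ler_wpM2r ?invr_ge0 //; apply: ler_sum => z _.
rewrite ler_wpM2l // (le_trans (gg x _ xxs)) //.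
by rewrite addrAC subrK.
Qed.

Lemma layersZ s (h : G -> R) c y :
  layers s (fun z => c * h z) y = c * layers s h y.
Proof.
elim: s y => [|i s IH] y //=; rewrite /shifts mulr_sumr.
by apply: eq_bigr => x _; rewrite IH.
Qed.

Lemma foldl_conv_ge0 (f : G -> R) (gs : I -> G -> R) s y :
  (forall z, 0 <= f z) -> (forall i z, 0 <= gs i z) ->
  0 <= foldl (conv B) f [seq gs i | i <- s] y.
Proof.
move=> f0 g0; elim: s f f0 => [|i s IH] f f0 /=; first exact: f0.
by apply: IH => z; apply: conv_ge0.
Qed.

Lemma foldl_convZ (f : G -> R) (gs : I -> G -> R) s c y :
  foldl (conv B) (fun z => c * f z) [seq gs i | i <- s] y
  = c * foldl (conv B) f [seq gs i | i <- s] y.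
Proof.
elim: s f => [|i s IH] f //=; rewrite -IH.
congr (foldl _ _ _ _); apply: funext => z; rewrite /conv mulrA mulr_sumr.
by congr (_ / _); apply: eq_bigr => u _; rewrite mulrA.
Qed.

(** Each convolution with [S i] absorbs the layer of [v i]: by [conv_shifts_le] it turns [S i] into
    [A i] at the cost of a factor [m], and the remaining layers commute with the convolution. *)
Lemma foldl_conv_layers m (f h : G -> R) (S A : I -> G -> R) s y :
  (forall i, size (v i) = m) -> (forall i x, x \in v i -> x \in B) ->
  (forall i z, 0 <= S i z) -> (forall i z, 0 <= A i z) -> (forall z, 0 <= h z) ->
  (forall i x z, x \in v i -> S i z <= A i (z + x)) ->
  (forall z, f z <= layers s h z) ->
  foldl (conv B) f [seq S i | i <- s] y
  <= m%:R ^+ size s * foldl (conv B) h [seq A i | i <- s] y.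
Proof.
move=> sz vB S0 A0 h0 SA.
have l0 t g : (forall z, 0 <= g z) -> forall z, 0 <= layers t g z.
  move=> g0; elim: t => [|i t IH] z //=.
  by apply: sumr_ge0.
elim: s f h h0 => [|i s IH] f h h0 fh /=; first by rewrite mul1r.
have st z : conv B f (S i) z <= layers s (fun u => m%:R * conv B h (A i) u) z.
  rewrite layersZ -conv_layers //.
  apply: (le_trans (ler_conv _ fh (S0 i))) => /=.
  rewrite -(sz i); apply: conv_shifts_le => // [x|z'|x z']; first exact: vB.
    exact: l0.
  exact: SA.
apply: (le_trans (IH _ _ _ st)) => [z|]; first by rewrite mulr_ge0 // conv_ge0.
by rewrite foldl_convZ exprS -mulrA mulrCA.
Qed.

End Convolution.
End Layers.

(** Cauchy-Schwarz on the support, from the nonnegativity of the sum of [(r y - t) ^+ 2] at the mean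
    value [t] of [r] there. *)
Lemma sum_sqr_support (R : realType) (T : finType) (r : T -> R) :
  (\sum_y r y) ^+ 2 <= #|[set y | r y != 0]|%:R * \sum_y r y ^+ 2.
Proof.
set L := [set y | _]; set S := \sum_y r y; set Q := \sum_y _.
have SL : S = \sum_(y in L) r y.
  rewrite /S [RHS]big_mkcond; apply: eq_bigr => y _; rewrite inE.
  by case: eqP => [->|].
have QL : Q = \sum_(y in L) r y ^+ 2.
  rewrite /Q [RHS]big_mkcond; apply: eq_bigr => y _; rewrite inE.
  by case: eqP => [->|] //=; rewrite expr0n.
have h t : 0 <= Q - 2 * t * S + t ^+ 2 * #|L|%:R.
  have -> : Q - 2 * t * S + t ^+ 2 * #|L|%:R = \sum_(y in L) (r y - t) ^+ 2.
    rewrite QL SL -sum1_card natr_sum !mulr_sumr -sumrB -big_split /=.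
    by apply: eq_bigr => y _; ring.
  by apply: sumr_ge0 => y _; exact: sqr_ge0.
have [L0|L0] := posnP #|L|.
  by rewrite SL (cards0_eq L0) big_set0 expr0n cards0 mul0r.
have LR : 0 < #|L|%:R :> R by rewrite ltr0n.
have := h (S / #|L|%:R); set n := #|L|%:R in LR *.
have -> : Q - 2 * (S / n) * S + (S / n) ^+ 2 * n = Q - S ^+ 2 / n.
  by field; rewrite gt_eqF.
by rewrite subr_ge0 ler_pdivrMr // mulrC.
Qed.

(** * The second moment of a random sumset *)

Section Selection.
Variables (R : realType) (G : finZmodType) (X : finType) (chi : X -> real_char R G).
Hypothesis orth : forall x : G, \sum_xi re (chi xi) x = #|X|%:R * (x == 0)%:R.
Hypothesis X_gt0 : (0 < #|X|)%N.
Variables (k m : nat) (B A1 V : {set G}) (A : 'I_k -> {set G}) (a1 d : R).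
Hypotheses (k_gt0 : (0 < k)%N) (m_gt0 : (0 < m)%N).
Hypotheses (sB : zsubgroup B) (sV : zsubgroup V).
Hypotheses (A1_gt0 : (0 < #|A1|)%N) (A_gt0 : forall i, (0 < #|A i|)%N).
Hypothesis sAB : forall i, A i \subset B.
Hypotheses (a1_ge0 : 0 <= a1) (d_ge0 : 0 <= d) (dm : d * m%:R <= 2^-1).
Hypothesis spectrum_trivial : forall i xi, d * #|A i|%:R ^+ 2 < spow chi (enum (A i)) xi ->
  forall v, v \in V -> re (chi xi) v = 1.
Hypothesis no_increment :
  forall y, shifts (enum V) (indic R A1) y <= 2 * a1 * #|V|%:R.

Let i1 : G -> R := indic R A1.

Lemma sum_indic (Y : {set G}) : \sum_y indic R Y y = #|Y|%:R.
Proof. by rewrite -natr_sum -big_mkcond sum1_card. Qed.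

Lemma sum_fpow_indic : \sum_xi fpow chi i1 xi = #|X|%:R * #|A1|%:R.
Proof.
rewrite (parseval orth) -sum_indic; congr (_ * _); apply: eq_bigr => y _.
by rewrite /i1 /indic; case: (y \in A1); rewrite ?expr1n ?expr0n.
Qed.

(** Summing over shifts by [V] multiplies these coefficients by [#|V| ^ 2]. Parseval then bounds
    them by the square sum of the shifted indicator, which is at most its supremum times its total
    mass. *)
Lemma sum_fpow_trivial :
  \sum_(xi | [forall v in V, re (chi xi) v == 1]) fpow chi i1 xi
  <= #|X|%:R * (2 * a1 * #|A1|%:R).
Proof.
have V0 : 0 < #|V|%:R :> R by rewrite ltr0n zsubgroup_card_gt0.
rewrite -(ler_pM2r (exprn_gt0 2 V0)) mulr_suml.
apply: (@le_trans _ _ (\sum_xi fpow chi (shifts (enum V) i1) xi)).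
  rewrite big_mkcond; apply: ler_sum => xi _; case: ifP => [/forallP h|_]; last exact: fpow_ge0.
  have {}h v : v \in V -> re (chi xi) v = 1 by move=> vV; apply/eqP; apply: implyP (h v) vV.
  rewrite fpow_shifts ler_wpM2l ?fpow_ge0 // /spow !big_enum /=.
  rewrite (eq_bigr (fun=> 1)) // sumr_const -[leLHS]addr0 lerD2l; exact: sqr_ge0.
rewrite (parseval orth) -[leRHS]mulrA ler_wpM2l //.
apply: (@le_trans _ _ (\sum_y 2 * a1 * #|V|%:R * shifts (enum V) i1 y)).
  apply: ler_sum => y _; rewrite expr2 ler_wpM2r //.
  by apply: sumr_ge0 => x _; rewrite /i1 /indic.
rewrite -mulr_sumr sum_shifts sum_indic -cardE.
by rewrite le_eqVlt; apply/orP; left; apply/eqP; ring.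
Qed.

Let sample := {ffun 'I_m -> G}.
Let w i (x : sample) : R := #|common_shift B (A i) x|%:R.
(** First term: frequencies trivial on [V], each tuple bounded by [m ^+ 2]. Second term: all other
    frequencies, with mean at most [3 / 2 * m] for each tuple. *)
Let M : R := #|A1|%:R * (2 * a1 * (m%:R ^+ 2) ^+ k + (3 / 2 * m%:R) ^+ k).
Let r (f : {ffun 'I_k -> sample}) := layers (fun i => codom (f i)) (enum 'I_k) i1.

(** After Parseval the tuples are independent at each frequency, so the mean factors into the
    [b i xi], estimated according to whether [xi] is trivial on [V]. *)
Lemma sampled_second_moment :
  \sum_(f : {ffun 'I_k -> sample}) (\prod_i w i (f i)) * (\sum_y r f y ^+ 2)
  <= M * \prod_i \sum_x w i x.
Proof.
have XR : 0 < #|X|%:R :> R by rewrite ltr0n.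
rewrite -(ler_pM2l XR) mulr_sumr.
set P := \prod_i _; have P0 : 0 <= P.
  by apply: prodr_ge0 => i _; apply: sumr_ge0.
pose b i xi := \sum_x w i x * spow chi (codom x) xi.
have b0 i xi : 0 <= b i xi by apply: sumr_ge0 => x _; rewrite mulr_ge0 ?spow_ge0.
have -> : \sum_(f : {ffun 'I_k -> sample}) #|X|%:R * ((\prod_i w i (f i)) * (\sum_y r f y ^+ 2))
   = \sum_xi fpow chi i1 xi * \prod_i b i xi.
  under eq_bigr do rewrite mulrCA -(parseval orth) mulr_sumr.
  rewrite exchange_big /=; apply: eq_bigr => xi _.
  rewrite /b -(sum_ffun_prod (fun i x => w i x * spow chi (codom x) xi)) mulr_sumr.
  apply: eq_bigr => f _; rewrite fpow_layers big_enum /= big_split /=; ring.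
pose triv xi := [forall v in V, re (chi xi) v == 1].
have bnd xi : fpow chi i1 xi * \prod_i b i xi <=
   P * ((if triv xi then fpow chi i1 xi else 0) * (m%:R ^+ 2) ^+ k
        + fpow chi i1 xi * (3 / 2 * m%:R) ^+ k).
  have c0 : 0 <= 3 / 2 * m%:R :> R by rewrite mulr_ge0 // divr_ge0.
  case: ifPn => [_|ht].
    apply: (@le_trans _ _ (P * (fpow chi i1 xi * (m%:R ^+ 2) ^+ k))); last first.
      by rewrite ler_wpM2l // lerDl mulr_ge0 ?fpow_ge0 // exprn_ge0.
    rewrite mulrCA ler_wpM2l ?fpow_ge0 //.
    have -> : (m%:R ^+ 2) ^+ k = \prod_(i < k) m%:R ^+ 2 :> R by rewrite prodr_const card_ord.
    rewrite -big_split /=; apply: ler_prod => i _; rewrite b0 /= mulr_suml.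
    apply: ler_sum => x _; rewrite ler_wpM2l //.
    by have := spow_le chi (codom x) xi; rewrite size_codom card_ord.
  rewrite mul0r add0r mulrCA ler_wpM2l ?fpow_ge0 //.
  have -> : (3 / 2 * m%:R) ^+ k = \prod_(i < k) (3 / 2 * m%:R) :> R.
    by rewrite prodr_const card_ord.
  rewrite -big_split /=; apply: ler_prod => i _; rewrite b0 /=.
  rewrite sum_common_shift; apply: sum_common_shift_spow_le d_ge0 dm _.
  rewrite leNgt; apply: contra ht => hs; apply/forallP => v; apply/implyP => vV.
  by apply/eqP; apply: spectrum_trivial hs _ vV.
apply: (le_trans (ler_sum _ (fun xi _ => bnd xi))).
rewrite -mulr_sumr big_split /= -!mulr_suml sum_fpow_indic -big_mkcond /=.
rewrite [leRHS](_ : _ = P * (#|X|%:R * (2 * a1 * #|A1|%:R) * (m%:R ^+ 2) ^+ k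
   + #|X|%:R * #|A1|%:R * (3 / 2 * m%:R) ^+ k)); last by rewrite /M; ring.
by rewrite ler_wpM2l // lerD2r ler_wpM2r ?sum_fpow_trivial // exprn_ge0 // sqr_ge0.
Qed.

Lemma exists_sample : exists f : {ffun 'I_k -> sample},
  \sum_y r f y ^+ 2 <= 2 * M /\
  forall i, (0 < #|common_shift B (A i) (f i)|)%N /\
    (#|B|%:R : R) * #|A i|%:R ^+ m
    <= #|B|%:R ^+ m * (2 * k%:R * #|common_shift B (A i) (f i)|%:R).
Proof.
have BR : 0 < #|B|%:R :> R by rewrite ltr0n zsubgroup_card_gt0.
have Z i : \sum_x w i x = #|B|%:R * #|A i|%:R ^+ m by exact: sum_common_shift.
have Z0 i : 0 < \sum_x w i x by rewrite Z mulr_gt0 // exprn_gt0 // ltr0n.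
have M0 : 0 < M.
  rewrite mulr_gt0 ?ltr0n // ltr_wpDl //.
    by rewrite !mulr_ge0 // exprn_ge0 // sqr_ge0.
  by rewrite exprn_gt0 // mulr_gt0 ?divr_gt0 // ltr0n.
(* The total weight divided by the number of tuples with entries in [B]; [hc] shows that only such
   tuples have nonzero weight. *)
pose c i : R := #|B|%:R * #|A i|%:R ^+ m / #|B|%:R ^+ m.
have c0 i : 0 <= c i by rewrite divr_ge0 ?mulr_ge0 ?exprn_ge0.
have w_ge0 i x : 0 <= w i x by exact: ler0n.
have Q0 f : 0 <= \sum_y r f y ^+ 2 by apply: sumr_ge0 => y _; exact: sqr_ge0.
have hc i : c i * #|[set x | w i x != 0]|%:R <= \sum_x w i x.
  rewrite Z /c mulrAC ler_pdivrMr ?exprn_gt0 // ler_wpM2l ?mulr_ge0 ?exprn_ge0 //.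
  rewrite -natrX ler_nat.
  rewrite -[m in (_ ^ m)%N]card_ord -card_ffun_on subset_leq_card //.
  apply/subsetP => x; rewrite inE pnatr_eq0 cards_eq0 => /set0Pn[s].
  rewrite inE => /andP[sB' /forallP hs]; apply/ffun_onP => j.
  by have := subsetP (sAB i) _ (hs j); rewrite addrC (zsubgroupDr sB).
have [f [hQ hw]] := weighted_selection w_ge0 Z0 k_gt0 Q0 M0 c0 sampled_second_moment hc.
exists f; split=> // i; have [w0 cw] := hw i; split; first by rewrite -(ltr0n R).
by move: cw; rewrite /c ler_pdivrMr ?exprn_gt0 // [leRHS]mulrC.
Qed.

End Selection.

(** * Bohr sets *)

Lemma cos_sin_modn (R : realType) (p n : nat) : (0 < p)%N ->
  cos (pi *+ 2 * (n %% p)%:R / p%:R) = cos (pi *+ 2 * n%:R / p%:R) :> R /\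
  sin (pi *+ 2 * (n %% p)%:R / p%:R) = sin (pi *+ 2 * n%:R / p%:R) :> R.
Proof.
move=> p0; have pR : p%:R != 0 :> R by rewrite pnatr_eq0 -lt0n.
have -> : pi *+ 2 * n%:R / p%:R
   = pi *+ 2 * (n %% p)%:R / p%:R + pi *+ 2 *+ (n %/ p) :> R.
  rewrite {1}(divn_eq n p) natrD natrM -[_ *+ (n %/ p)]mulr_natr; field.
  exact: pR.
by rewrite (periodicn (@cosD2pi R)) (periodicn (@sinD2pi R)).
Qed.

(** * A non-trivial additive character of a finite field *)

Section CircleCharacter.
Variables (R : realType) (p : nat).
Hypothesis p_pr : prime p.

Definition angle (x : 'F_p) : R := pi *+ 2 * (x : nat)%:R / p%:R.

Lemma cos_sin_angleD x y :
  cos (angle (x + y)) = cos (angle x + angle y) /\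
  sin (angle (x + y)) = sin (angle x + angle y).
Proof.
have -> : angle (x + y) = pi *+ 2 * ((x + y)%N %% p)%:R / p%:R.
  by rewrite /angle /= [in X in (_ %% X)%N]Fp_cast.
have [-> ->] := cos_sin_modn R (x + y) (prime_gt0 p_pr).
by rewrite /angle natrD mulrDr mulrDl.
Qed.

Fact cos_angleD x y : cos (angle (x + y)) =
  cos (angle x) * cos (angle y) - sin (angle x) * sin (angle y).
Proof. by have [-> _] := cos_sin_angleD x y; rewrite cosD. Qed.

Fact sin_angleD x y : sin (angle (x + y)) =
  sin (angle x) * cos (angle y) + cos (angle x) * sin (angle y).
Proof. by have [_ ->] := cos_sin_angleD x y; rewrite sinD. Qed.

Definition circle_char : real_char R 'F_p :=
  RealChar cos_angleD sin_angleD (fun x => cos2Dsin2 (angle x)).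

(** As [p >= 2], the angle [2 pi / p] lies in [(0, pi]], and [cos] is injective on [[0, pi]]. *)
Lemma circle_char1 : re circle_char 1 != 1.
Proof.
have p1 := prime_gt1 p_pr.
have p2 : 2 <= p%:R :> R by rewrite (ler_nat _ 2).
have pR : 0 < p%:R :> R by lra.
have pi0 := @pi_gt0 R.
have t0 : 0 < pi *+ 2 / p%:R :> R by rewrite divr_gt0 // pmulrn_lgt0.
have -> : re circle_char 1 = cos (pi *+ 2 / p%:R) by rewrite /= /angle /= mulr1.
rewrite -[X in _ != X](@cos0 R); apply: contraTneq (t0) => h.
suff -> : pi *+ 2 / p%:R = 0 :> R by rewrite ltxx.
apply: cos_inj h; rewrite in_itv /=; last by rewrite lexx ltW.
by rewrite (ltW t0) /= ler_pdivrMr // -[leLHS]mulr_natr ler_pM2l.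
Qed.

End CircleCharacter.

(** A coordinate of the field over its prime field is additive and takes the value 1 on its basis
    vector; compose it with the circle character. *)
Lemma exists_nontrivial_char (R : realType) (F : finFieldType) :
  exists psi : real_char R F, exists u, re psi u != 1.
Proof.
have [p p_pr charFp] := finPcharP F.
pose L := pPrimeCharType charFp.
have d0 : (0 < \dim {:L})%N.
  exact: (adim_gt0 {:L}%AS).
pose i := Ordinal d0.
pose phi (x : F) : 'F_p := coord (vbasis {:L}) i (x : L).
have phiD : {morph phi : x y / x + y} by move=> x y; exact: (linearD (coord (vbasis {:L}) i)).
exists (pull_char phiD (circle_char R p_pr)).
exists ((vbasis {:L})`_i : L) => /=.
have -> : phi ((vbasis {:L})`_i : L) = 1.
  rewrite /phi coord_free ?eqxx //; exact: basis_free (vbasisP _).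
exact: circle_char1.
Qed.

Section Pairing.
Variables (F : finFieldType) (N : nat).
Local Notation G := {poly_N F}.

Definition coef_pairing (xi x : G) : F := \sum_(j < N) xi`_j * x`_j.

Lemma coef_pairingC xi x : coef_pairing xi x = coef_pairing x xi.
Proof. by apply: eq_bigr => j _; rewrite mulrC. Qed.

Lemma coef_pairingD xi : {morph coef_pairing xi : x y / x + y}.
Proof.
move=> x y; rewrite /coef_pairing -big_split /=; apply: eq_bigr => j _.
by rewrite coefD mulrDr.
Qed.

Lemma coef_pairing_onto (x : G) (u : F) : x != 0 -> exists v, coef_pairing v x = u.
Proof.
move=> x0; have [j xj] : exists j : 'I_N, x`_j != 0.
  apply/existsP; apply: contraNT x0; rewrite negb_exists => /forallP h.
  apply/eqP/npolyP => i; rewrite coef0.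
  have [iN|iN] := ltnP i N; last exact: big_coef_npoly.
  by apply/eqP; move: (h (Ordinal iN)); rewrite negbK.
exists (npolyp N ((u / x`_j) *: 'X^j)); rewrite /coef_pairing (bigD1 j) //= big1.
  by rewrite coef_npolyp ltn_ord coefZ coefXn eqxx mulr1 addr0 divfK.
move=> l; rewrite -val_eqE /= => /negPf nlj.
by rewrite coef_npolyp ltn_ord coefZ coefXn nlj mulr0 mul0r.
Qed.

(** By symmetry of the pairing, the sum over frequencies at [x] is the sum over all points of the
    character indexed by [x], non-trivial when [x != 0]. *)
Lemma pairing_orthogonality (R : realType) (psi : real_char R F) u (x : G) :
  re psi u != 1 ->
  \sum_xi re (pull_char (coef_pairingD xi) psi) x = #|{: G}|%:R * (x == 0)%:R.
Proof.
move=> nu; have [->|x0] := eqVneq x 0.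
  rewrite (eq_bigr (fun=> 1)) => [|xi _]; last by rewrite re0.
  by rewrite sumr_const mulr1 cardT.
have [v vu] := coef_pairing_onto u x0.
have nv : re (pull_char (coef_pairingD x) psi) v != 1 by rewrite /= coef_pairingC vu.
have sT : zsubgroup [set: G] by split=> [|? ? _ _]; rewrite inE.
have [h _] := sum_char_eq0 sT (fun _ => erefl (1 : R)) (in_setT v) nv.
rewrite mulr0 -[RHS]h; apply: eq_big => [xi|xi _]; first by rewrite inE.
by rewrite mul1r /= coef_pairingC.
Qed.

End Pairing.

Section BohrSets.
Variables (F : finFieldType) (N : nat).
Local Notation G := {poly_N F}.

Lemma poly_mul_seriesE (x : G) (a : int -> F) i :
  poly_mul_series x a i = \sum_(j < N) x`_j * a (i - j%:Z).
Proof.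
rewrite /poly_mul_series (big_ord_widen N (fun j => x`_j * a (i - j%:Z))) ?size_npoly //.
rewrite big_mkcond /=; apply: eq_bigr => j _; case: ltnP => // h.
by rewrite nth_default // mul0r.
Qed.

(** The degree condition becomes a finite system of linear equations in [x], one for each exponent
    from [- kappa] to -1. *)
Lemma bohr_setP (b : bohr F) (x : G) :
  reflect (forall (xi : int -> F) (h : xi \in domf (width b)) (i : int),
             i < 0 -> - (width b [` h]%fset)%:Z <= i -> poly_mul_series x xi i = 0)
          (x \in bohr_set N b).
Proof.
rewrite inE; apply: (iffP (asboolP _)) => [H xi h i i0 hi|H xi i].
  apply/eqP; apply: contraLR hi => nz; rewrite -ltNge.
  by apply: (H [` h]%fset); rewrite /frac_part i0.
rewrite /frac_part; case: ifP => i0 nz; last by rewrite eqxx in nz.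
rewrite ltNge; apply: contra nz => hi; apply/eqP.
by case: xi hi => xi h /= hi; apply: (H xi h).
Qed.

Lemma bohr_set_subgroup (b : bohr F) : zsubgroup (bohr_set N b).
Proof.
split=> [|x y /bohr_setP Hx /bohr_setP Hy]; apply/bohr_setP => xi h i i0 hi.
  by rewrite poly_mul_seriesE big1 // => j _; rewrite coef0 mul0r.
rewrite poly_mul_seriesE.
transitivity (poly_mul_series x xi i - poly_mul_series y xi i).
  by rewrite !poly_mul_seriesE -sumrB; apply: eq_bigr => j _; rewrite coefB mulrBl.
by rewrite (Hx _ h) // (Hy _ h) // subrr.
Qed.

(* [\sum_(j < N) xi_j t^(-1-j)]: the coefficient of [t^-1] in its product with [x] is
   the pairing of [xi] and [x]. *)
Definition dual_series (xi : G) : int -> F :=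
  fun i => if i < 0 then xi`_(`|i|.-1)%N else 0.

Lemma dual_series_torus xi : in_torus (dual_series xi).
Proof. by move=> i; rewrite /dual_series; case: ifP => //; rewrite eqxx. Qed.

Lemma poly_mul_dual_series (xi x : G) :
  poly_mul_series x (dual_series xi) (-1) = coef_pairing xi x.
Proof.
rewrite poly_mul_seriesE; apply: eq_bigr => j _; rewrite mulrC; congr (_ * _).
rewrite /dual_series (_ : -1 - j%:Z < 0); last by lia.
by congr nth; lia.
Qed.

Section Refinement.
Variables (b : bohr F) (s : seq G).
Open Scope fset_scope.

Let new : {fset (int -> F)} := [fset dual_series xi | xi in s].

(** A new frequency gets width at least 1, which kills its coefficient of [t^-1]; [maxn] keeps the
    condition of a frequency already present, and the default 0 imposes none. *)
Definition refine_width : {fmap (int -> F) -> nat} :=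
  [fmap xi : (domf (width b) `|` new) =>
     maxn (odflt 0%N (width b).[? val xi]%fmap) (val xi \in new)]%fmap.

Lemma refine_torus (xi : domf refine_width) : in_torus (val xi).
Proof.
have := valP xi; rewrite in_fsetU => /orP[h|/imfsetP[eta _ ->]].
  exact: (@width_torus F b (FSetSub h)).
exact: dual_series_torus.
Qed.

Definition bohr_refine : bohr F := Bohr refine_torus.

Lemma rk_refine : (rk bohr_refine <= rk b + size s)%N.
Proof.
rewrite /rk /= (leq_trans (leq_card_fsetU _ _)) // leq_add2l.
apply: leq_trans (leq_imfset_card _ _ _) _; exact: size_undup.
Qed.

Lemma refine_widthE (xi : int -> F) (h : xi \in domf refine_width) :
  refine_width (FSetSub h) = maxn (odflt 0%N (width b).[? xi]%fmap) (xi \in new).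
Proof. by rewrite ffunE. Qed.

Lemma refine_set : bohr_set N bohr_refine = annihilator (@coef_pairing F N) (bohr_set N b) s.
Proof.
apply/setP => x; rewrite [RHS]inE; apply/bohr_setP/andP => [H|[/bohr_setP Hb /allP Hs] xi h i i0].
  split; first (apply/bohr_setP => xi h i i0 hi).
    have h' : xi \in domf refine_width by rewrite in_fsetU h.
    apply: (H xi h' i i0); rewrite refine_widthE (in_fnd h) /=.
    apply: le_trans hi; rewrite lerN2 lez_nat; exact: leq_maxl.
  apply/allP => eta etas; apply/eqP; rewrite -poly_mul_dual_series.
  have hn : dual_series eta \in new by apply/imfsetP; exists eta.
  have h' : dual_series eta \in domf refine_width by rewrite in_fsetU hn orbT.
  apply: (H _ h') => //; rewrite refine_widthE hn lerN2 lez_nat; exact: leq_maxr.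
rewrite refine_widthE => hi.
(* Either the old width already covers the exponent [i], or the bound comes from a new frequency and
   forces [i = -1]. *)
have [hw|hw] := leP (- (odflt 0%N (width b).[? xi]%fmap)%:Z) i.
  case: fndP hw => [hb hw|_ hw]; first exact: Hb hw.
  by move: i0 hw; rewrite /=; lia.
case: imfsetP hi => [[eta /= etas xiE] hi|_ hi]; last by rewrite /= in hi; lia.
have -> : i = -1 by rewrite /= in hi; lia.
by rewrite xiE poly_mul_dual_series; apply/eqP/Hs.
Qed.

End Refinement.
End BohrSets.

(** * The dichotomy *)

Section Dichotomy.
Variables (R : realType) (G H : finZmodType) (X : finType) (l : X -> G -> H).
Hypothesis lD : forall xi, {morph l xi : x y / x + y}.
Variable psi : real_char R H.
Let chi xi : real_char R G := pull_char (lD xi) psi.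
Variables (k : nat) (B A1 : {set G}) (A : 'I_k -> {set G}) (alpha : R).
Hypothesis sB : zsubgroup B.
Hypotheses (sA1B : A1 \subset B) (sAB : forall i, A i \subset B).
Hypotheses (alpha_gt0 : 0 < alpha) (A_dense : forall i, alpha * #|B|%:R <= #|A i|%:R).

(** Chang's bound at threshold [sqrt d] for each [A i]; the annihilator of the concatenated chains
    lies in that of every single chain. *)
Lemma common_spectrum_annihilator (d : R) : 0 < d <= 1 ->
  exists2 s : seq X, (size s)%:R * d <= k%:R * (8 * ln (alpha^-1)) &
    forall i xi, d * #|A i|%:R ^+ 2 < spow chi (enum (A i)) xi ->
      forall v, v \in annihilator l B s -> re (chi xi) v = 1.
Proof.
move=> /andP[d0 d1]; pose eps := Num.sqrt d.
have epsE : eps ^+ 2 = d by rewrite sqr_sqrtr // ltW.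
have eps01 : 0 < eps <= 1.
  rewrite sqrtr_gt0 d0 /= -(@ler_pXn2r _ 2) ?nnegrE ?sqrtr_ge0 //.
  by rewrite epsE expr1n.
have /choice[s hs] : forall i, exists s : seq X, (size s)%:R * d <= 8 * ln (alpha^-1) /\
    forall xi, d * #|A i|%:R ^+ 2 < spow chi (enum (A i)) xi ->
      forall v, v \in annihilator l B s -> re (chi xi) v = 1.
  move=> i.
  have [s cs hs] := exists_maximal_chain lD psi
    (fun xi => (eps * #|A i|%:R) ^+ 2 < spow chi (enum (A i)) xi) sB.
  exists s; split.
    rewrite -epsE; exact: (chang_bound sB (sAB i) alpha_gt0 (A_dense i) eps01 cs).
  by move=> xi hxi v; apply: hs; rewrite exprMn epsE.
exists (flatten [seq s i | i <- enum 'I_k]).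
  rewrite size_flatten /shape -map_comp sumnE big_map big_enum /= natr_sum mulr_suml.
  apply: (@le_trans _ _ (\sum_(i < k) 8 * ln (alpha^-1))).
    by apply: ler_sum => i _; case: (hs i).
  by rewrite sumr_const card_ord -[leLHS]mulr_natl.
move=> i xi hxi v hv; have [_ h] := hs i; apply: h hxi _ _.
move: hv; rewrite !inE => /andP[-> /allP hv]; apply/allP => eta he; apply: hv.
by apply/flattenP; exists (s i) => //; apply: map_f; rewrite mem_enum.
Qed.

Lemma shifts_indic_subgroup (V : {set G}) y : zsubgroup V ->
  shifts (enum V) (indic R A1) y = #|translate A1 (- y) :&: V|%:R.
Proof.
move=> sV; rewrite /shifts big_enum /= /indic -natr_sum -big_mkcondr sum1dep_card.
congr (_%:R); rewrite -(card_imset _ oppr_inj); apply: eq_card => u.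
apply/imsetP/setIP => [[v]|[/imsetP[a aA ->] uV]].
  rewrite inE => /andP[vV hv] ->; split; last exact: zsubgroupN.
  by apply/imsetP; exists (y - v) => //; rewrite addrC addKr.
exists (y - a); last by rewrite opprB.
by rewrite inE -{1}(opprB a y) zsubgroupN //= opprB addrC subrK.
Qed.

(** For [y] in [B] the shifted sum is the count of the first alternative at [x = - y]; for other [y]
    it vanishes, as [A1] and [V] lie in [B]. *)
Lemma increment_or_bounded_shifts (V : {set G}) (c : R) : zsubgroup V -> V \subset B ->
  0 <= c ->
  (exists2 x, x \in B & c <= #|translate A1 x :&: V|%:R) \/
  (forall y, shifts (enum V) (indic R A1) y <= c).
Proof.
move=> sV VB c0; have [h|h] := pselect (exists2 x, x \in B & c <= #|translate A1 x :&: V|%:R).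
  by left.
right=> y; have [yB|yB] := boolP (y \in B).
  rewrite shifts_indic_subgroup // leNgt; apply/negP => h2; apply: h.
  by exists (- y); [exact: zsubgroupN | exact: ltW].
rewrite /shifts big_seq big1 // => v; rewrite mem_enum => vV.
rewrite /indic (negPf (_ : y - v \notin A1)) //.
apply: contra yB => /(subsetP sA1B) h2.
by rewrite -(subrK v y) zsubgroupD // (subsetP VB).
Qed.

End Dichotomy.

(** Used with [p = m^k], [a = alpha1], [b = #|B|], [n = #|L|] and [q] the second moment. As
    [p * a >= 1], both terms of the bound on [q] are of order [a * p^2], giving
    [b <= 6 * 2^k * n]. *)
Lemma ratio_ge_of_second_moment (R : realType) (k : nat) (p a b n q : R) :
  0 < a -> 0 < b -> 0 <= n -> 1 <= p * a ->
  (p * (a * b)) ^+ 2 <= n * q ->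
  q <= 2 * (a * b * (2 * a * p ^+ 2 + (3 / 2) ^+ k * p)) ->
  2 ^- (k + 6) <= n / b.
Proof.
move=> a0 b0 n0 pa h1 h2.
have p0 : 0 < p by rewrite -(pmulr_lgt0 _ a0); lra.
have t0 : (3 / 2) ^+ k <= 2 ^+ k :> R by rewrite lerXn2r ?nnegrE //; lra.
have o0 : 1 <= 2 ^+ k :> R by rewrite exprn_ege1 //; lra.
have t1 : 0 <= (3 / 2) ^+ k :> R by rewrite exprn_ge0 //; lra.
have pp : p <= a * p ^+ 2.
  rewrite expr2 mulrCA [a * p]mulrC -[leLHS]mulr1 ler_pM2l //.
have h3 : q <= 2 * (a * b * (a * p ^+ 2 * (3 * 2 ^+ k))).
  apply: (le_trans h2); rewrite ler_pM2l // ler_pM2l ?mulr_gt0 //.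
  have e1 : (3 / 2) ^+ k * p <= 2 ^+ k * (a * p ^+ 2).
    by apply: ler_pM => //; exact: ltW.
  have e2 : 2 * a * p ^+ 2 <= 2 * 2 ^+ k * (a * p ^+ 2).
    rewrite -mulrA; apply: ler_wpM2r; first by rewrite mulr_ge0 ?exprn_ge0 ?ltW.
    lra.
  lra.
have h4 : (p * (a * b)) ^+ 2 <= n * (2 * (a * b * (a * p ^+ 2 * (3 * 2 ^+ k)))).
  by apply: (le_trans h1); rewrite ler_wpM2l.
have h5 : b <= n * (6 * 2 ^+ k).
  have c0 : 0 < a ^+ 2 * p ^+ 2 * b by rewrite !mulr_gt0 ?exprn_gt0.
  rewrite -(ler_pM2l c0); apply: (le_trans _ (le_trans h4 _)).
    by rewrite le_eqVlt; apply/orP; left; apply/eqP; ring.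
  by rewrite le_eqVlt; apply/orP; left; apply/eqP; ring.
rewrite ler_pdivlMr // ler_pdivrMl ?exprn_gt0 // (le_trans h5) //.
rewrite mulrC exprD ler_wpM2r // [leRHS]mulrC ler_wpM2r ?exprn_ge0 //.
by rewrite -natrX ler_nat.
Qed.

(** * Thick and sparse first sets *)

Section DensityDichotomy.
Variables (R : realType) (k : nat) (F : finFieldType) (N : nat) (b : bohr F).
Variables (alpha : R) (A1 : {set {poly_N F}}) (A : 'I_k -> {set {poly_N F}}).
Let B : {set {poly_N F}} := bohr_set N b.
Let alpha1 : R := density R B A1.
Let delta : R := alpha1 `^ (- (k%:R)^-1).
Hypotheses (k_gt0 : (0 < k)%N) (sA1B : A1 \subset B) (alpha1_gt0 : 0 < alpha1).
Hypotheses (alpha_gt0 : 0 < alpha) (alpha_lt : alpha < expR (- 2)).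
Hypothesis A_dense : forall i, A i \subset B /\ alpha <= density R B (A i).

Let sB : zsubgroup B := bohr_set_subgroup N b.

Lemma bohr_card_gt0 : 0 < #|B|%:R :> R.
Proof. by rewrite ltr0n; exact: zsubgroup_card_gt0 sB. Qed.

Lemma density_sub (Y : {set {poly_N F}}) : Y \subset B ->
  density R B Y = #|Y|%:R / #|B|%:R.
Proof. by move=> YB; rewrite /density (setIidPl YB). Qed.

Lemma density_le1 : alpha1 <= 1.
Proof.
rewrite /alpha1 density_sub // ler_pdivrMr ?bohr_card_gt0 // mul1r ler_nat.
exact: subset_leq_card.
Qed.

Lemma delta_ge1 : 1 <= delta.
Proof.
rewrite -(powRr0 alpha1) ger_powR ?alpha1_gt0 ?density_le1 //.
by rewrite oppr_le0 invr_ge0.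
Qed.

Lemma delta_exprn : delta ^+ k = alpha1^-1.
Proof.
rewrite -powR_mulrn ?powR_ge0 // -powRrM mulNr mulVf ?pnatr_eq0 -?lt0n //.
by rewrite powR_inv1 // ltW.
Qed.

Lemma ln_inv_alpha_ge2 : 2 <= ln (alpha^-1).
Proof.
rewrite -ler_expR lnK ?posrE ?invr_gt0 // -[expR 2]invrK -expRN.
by rewrite lef_pV2 ?posrE ?expR_gt0 // ltW.
Qed.

Lemma alpha_lt1 : alpha < 1.
Proof. by rewrite (lt_trans alpha_lt) // expR_lt1; lra. Qed.

Lemma card_A1 : #|A1|%:R = alpha1 * #|B|%:R.
Proof. by rewrite /alpha1 density_sub // divfK // gt_eqF ?bohr_card_gt0. Qed.

Lemma card_A_ge i : alpha * #|B|%:R <= #|A i|%:R.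
Proof.
have [AB h] := A_dense i; move: h.
by rewrite density_sub // ler_pdivlMr ?bohr_card_gt0.
Qed.

(** The given sets themselves serve as [L] and [S], because [alpha1 ^- 2 >= 1] and
    [alpha < 1 <= K]. *)
Lemma thick_case (K : R) : 1 <= K -> 2 ^- (k + 6) <= alpha1 ->
  exists (L : {set {poly_N F}}) (S : 'I_k -> {set {poly_N F}}),
     [/\ L \subset B,
         forall i : 'I_k, S i \subset B,
         2 ^- (k + 6) <= density R B L,
         forall i : 'I_k, alpha `^ K <= density R B (S i) &
         forall x : {poly_N F},
           iter_conv R B L S x <= alpha1 ^- 2 * iter_conv R B A1 A x].
Proof.
move=> K1 h; exists A1, A; split=> // [i|i|x]; first by case: (A_dense i).
  have [_ ] := A_dense i; apply: le_trans.
  by rewrite -[leRHS](powRr1 (ltW alpha_gt0)) ger_powR // alpha_gt0 (ltW alpha_lt1).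
rewrite ler_peMl //.
  by apply: foldl_conv_ge0 => [z|i z]; rewrite /indic.
rewrite invf_ge1 ?exprn_gt0 // exprn_ile1 ?density_le1 // ltW //.
Qed.

(** In the constant, [32 * k * q] pays for the codimension of [V], and [k + 2] for the density of
    the [S i]. *)
Lemma sparse_case (C : R) (q : nat) : #|F| = q -> (0 < q)%N ->
  (32 * k * q + k + 2)%:R <= C -> alpha1 < 2 ^- (k + 6) ->
  let K := C * delta in
  (exists b' : bohr F, let B' : {set {poly_N F}} := bohr_set N b' in
     [/\ B' \subset B,
         (rk b')%:R <= (rk b)%:R + K * ln (alpha^-1),
         expR (- (K * ln (alpha^-1))) <= density R B B' &
         exists2 x, x \in B & 2 * alpha1 <= density R B' (translate A1 x)])
  \/
  (exists (L : {set {poly_N F}}) (S : 'I_k -> {set {poly_N F}}),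
     [/\ L \subset B,
         forall i : 'I_k, S i \subset B,
         2 ^- (k + 6) <= density R B L,
         forall i : 'I_k, alpha `^ K <= density R B (S i) &
         forall x : {poly_N F},
           iter_conv R B L S x <= alpha1 ^- 2 * iter_conv R B A1 A x]).
Proof.
move=> cardF q0 hC a1lt K.
have quarter (x y : R) : 1 <= x -> y <= 2 * x -> (4 * x)^-1 * y <= 2^-1.
  by move=> x1 xy; rewrite mulrC ler_pdivrMr; lra.
have addk (x y z : R) : 1 <= x -> y <= 2 * x -> 0 <= z -> y + z <= (z + 2) * x.
  by move=> x1 xy z0; nra.
have d1 := delta_ge1; have BR := bohr_card_gt0; have ln2 := ln_inv_alpha_ge2.
have dl0 : 0 <= delta * ln (alpha^-1) by rewrite mulr_ge0 //; lra.
have delta0 : 0 <= delta by lra.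
have [psi [u nu]] := exists_nontrivial_char R F.
have orth (x : {poly_N F}) := pairing_orthogonality x nu.
have XG : (0 < #|{: {poly_N F}}|)%N by apply/card_gt0P; exists 0.
have sAB i : A i \subset B by case: (A_dense i).
have A0 i : (0 < #|A i|)%N.
  by rewrite -(ltr0n R) (lt_le_trans _ (card_A_ge i)) // mulr_gt0.
have A10 : (0 < #|A1|)%N by rewrite -(ltr0n R) card_A1 mulr_gt0.
(* Since [m <= 2 * delta], this gives [d * m <= 1 / 2]; its factor 4 times the 8 of Chang's bound
   makes 32. *)
pose d := (4 * delta)^-1.
have d01 : 0 < d <= 1.
  rewrite invr_gt0 invf_le1; last by lra.
  by apply/andP; split; lra.
have [s hs triv] := common_spectrum_annihilator (@coef_pairingD F N) psi sB sAB
  alpha_gt0 card_A_ge d01.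
have /andP[d0 _] := d01.
set V := annihilator _ B s in triv.
have sV : zsubgroup V by exact: annihilator_subgroup (@coef_pairingD F N) _ _ sB.
have VB : V \subset B by apply/subsetP => x; rewrite inE => /andP[].
have VR : 0 < #|V|%:R :> R by rewrite ltr0n zsubgroup_card_gt0.
have size_s : (size s)%:R <= 32 * k%:R * delta * ln (alpha^-1).
  move: hs; rewrite -ler_pdivlMr // invrK => hs; apply: (le_trans hs).
  by rewrite le_eqVlt; apply/orP; left; apply/eqP; ring.
have qR : 1 <= q%:R :> R by rewrite ler1n.
have kR : 1 <= k%:R :> R by rewrite ler1n.
have hC' : 32 * k%:R * q%:R + k%:R + 2 <= C.
  by apply: le_trans hC; rewrite !natrD !natrM.
have size_q : (size s)%:R * q%:R <= K * ln (alpha^-1).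
  apply: (@le_trans _ _ (32 * k%:R * delta * ln (alpha^-1) * q%:R)).
    by rewrite ler_wpM2r.
  rewrite [leLHS](_ : _ = 32 * k%:R * q%:R * (delta * ln (alpha^-1))); last by ring.
  rewrite /K -[leRHS]mulrA ler_wpM2r //; apply: le_trans hC'.
  by rewrite -addrA lerDl addr_ge0.
have c0 : 0 <= 2 * alpha1 * #|V|%:R by rewrite mulr_ge0 // mulr_ge0 // ltW.
have [[x xB hx]|noinc] := increment_or_bounded_shifts sB sA1B sV VB c0.
  left; exists (bohr_refine b s) => /=; rewrite refine_set -/B -/V; split=> //.
  - have h := rk_refine b s; rewrite -(ler_nat R) natrD in h.
    apply: (le_trans h); rewrite lerD2l; apply: le_trans size_q.
    by rewrite ler_peMr.
  (* Each frequency costs a factor [q] in size, bounded by [expR q]. *)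
  - rewrite density_sub // ler_pdivlMr // expRN ler_pdivrMl ?expR_gt0 //.
    have := card_annihilator (@coef_pairingD F N) s sB.
    rewrite -/V cardF -(ler_nat R) natrM natrX => h; apply: (le_trans h).
    rewrite ler_pM2r //; apply: (@le_trans _ _ (expR (q%:R) ^+ size s)).
      rewrite lerXn2r ?nnegrE ?expR_ge0 //.
      by apply: le_trans (expR_ge1Dx _); rewrite lerDr.
    by rewrite -expRM_natl ler_expR.
  - exists x => //; rewrite /density ler_pdivlMr //.
right.
pose m := (Num.trunc delta).+1.
have [ml mu] : delta <= m%:R /\ m%:R <= 2 * delta.
  have /andP[h1 h2] := truncn_itv (le_trans ler01 d1).
  by split; [exact: ltW | rewrite /m -natr1 mulr_natl mulr2n lerD].
have dm : d * m%:R <= 2^-1.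
  exact: quarter.
have [f [hQ hf]] := exists_sample orth XG k_gt0 (ltn0Sn _ : (0 < m)%N) sB sV A10 A0 sAB
   (ltW alpha1_gt0) (ltW d0) dm triv noinc.
pose v i := codom (f i).
have szv i : size (v i) = m by rewrite size_codom card_ord.
have vB i x : x \in v i -> x \in B.
  move=> /codomP[j ->]; have [/card_gt0P[y] + _] := hf i.
  rewrite inE => /andP[yB /forallP /(_ j) /(subsetP (sAB i))].
  by rewrite addrC (zsubgroupDr sB).
pose r := layers v (enum 'I_k) (indic R A1).
pose L := [set y | r y != 0].
pose S i := common_shift B (A i) (f i).
have SB i : S i \subset B by apply/subsetP => y; rewrite inE => /andP[].
have LB : L \subset B.
  apply/subsetP => y; rewrite inE; apply: contraNT => yB; apply/eqP.
  apply: (layers_eq0 _ sB vB) yB => z zB.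
  by rewrite /indic (negPf (contra (subsetP sA1B z) zB)).
(* The lower bound makes the second moment argument work; the upper one controls the loss [m^k] in
   the convolution inequality. *)
have pk : (1 <= m%:R ^+ k * alpha1) /\ (m%:R ^+ k <= 2 ^+ k / alpha1).
  have e := delta_exprn; split.
    by rewrite -ler_pdivrMr // div1r -e lerXn2r ?nnegrE.
  by rewrite -e -exprMn lerXn2r ?nnegrE ?mulr_ge0.
exists L, S; split=> // [|i|x].
- rewrite density_sub //.
  apply: (@ratio_ge_of_second_moment R k (m%:R ^+ k) alpha1 _ _ (\sum_y r y ^+ 2)) => //.
  + by case: pk.
  + rewrite -card_A1 -sum_indic.
    have <- : \sum_y r y = m%:R ^+ k * \sum_y indic R A1 y.
      by rewrite (sum_layers _ _ szv) size_enum_ord.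
    exact: sum_sqr_support.
  + by apply: (le_trans hQ); rewrite -card_A1 exprAC exprMn.
- have [_ h] := hf i; rewrite density_sub // -/(S i) in h *.
  have aA : alpha ^+ m <= 2 * k%:R * (#|S i|%:R / #|B|%:R).
    rewrite mulrA ler_pdivlMr // -(ler_pM2l (exprn_gt0 m BR)) (le_trans _ h) //.
    rewrite mulrA [_ * #|B|%:R]mulrC ler_pM2l // mulrC -exprMn.
    by rewrite lerXn2r ?nnegrE ?mulr_ge0 ?card_A_ge // ltW.
  (* The loss [2 * k] from the selection is absorbed by [alpha ^+ k <= expR (- 2 k)]; this is where
     [alpha < expR (- 2)] enters. *)
  have k2 : alpha ^+ k * (2 * k%:R) <= 1.
    have e2 : alpha ^+ k <= (expR (2 * k%:R))^-1.
      rewrite -expRN -mulNr expRM_natr lerXn2r ?nnegrE ?expR_ge0 ?ltW //.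
    have e3 : 2 * k%:R <= expR (2 * k%:R) :> R by apply: le_trans (expR_ge1Dx _); rewrite lerDr.
    apply: (@le_trans _ _ ((expR (2 * k%:R))^-1 * expR (2 * k%:R))).
      by rewrite ler_pM ?exprn_ge0 ?mulr_ge0 // ltW.
    by rewrite mulVf // gt_eqF // expR_gt0.
  have mk : alpha `^ K <= alpha ^+ (m + k).
    rewrite -(powR_mulrn _ (ltW alpha_gt0)) ger_powR ?alpha_gt0 ?(ltW alpha_lt1) //.
    rewrite natrD /K; apply: (@le_trans _ _ ((k%:R + 2) * delta)); first exact: addk.
    rewrite ler_wpM2r //; apply: le_trans hC'; rewrite -addrA lerDr !mulr_ge0 //.
  apply: (le_trans mk); rewrite exprD.
  have p0 : 0 <= #|S i|%:R / #|B|%:R :> R by rewrite divr_ge0.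
  apply: (@le_trans _ _ (2 * k%:R * (#|S i|%:R / #|B|%:R) * alpha ^+ k)).
    by rewrite ler_wpM2r // exprn_ge0 // ltW.
  by rewrite mulrAC [leLHS]mulrC -[leRHS]mulr1 ler_wpM2l // mulrC.
- have le1 : iter_conv R B L S x <= m%:R ^+ k * iter_conv R B A1 A x.
    have -> : m%:R ^+ k = m%:R ^+ size (enum 'I_k) :> R by rewrite size_enum_ord.
    apply: (@foldl_conv_layers _ _ _ v _ sB m) => // [i y z|z].
    + move=> /codomP[j ->]; rewrite /indic inE.
      case: (z \in B) => //=; case: forallP => [->|] //.
    + rewrite /indic inE -/(r z); have := @layers_nat R _ _ v (enum 'I_k) (indic R A1) z.
      rewrite -/r => /(_ _)/natrP[y|n ->]; first exact: rpred_nat.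
      by rewrite pnatr_eq0 ler_nat; case: n.
  apply: (le_trans le1); rewrite ler_wpM2r //.
    by apply: foldl_conv_ge0 => [z|i z]; rewrite /indic.
  have [_ h] := pk; apply: (le_trans h).
  (* It remains that [2 ^+ k <= alpha1^-1], which follows from [alpha1 < 2 ^- (k + 6)]. *)
  rewrite ler_pdivrMr // expr2 invfM -mulrA mulVf ?gt_eqF // mulr1.
  rewrite -[leLHS]invrK lef_pV2 ?posrE ?invr_gt0 ?exprn_gt0 // ltW //.
  apply: (lt_le_trans a1lt); rewrite lef_pV2 ?posrE ?exprn_gt0 //.
  by rewrite exprD ler_peMr ?exprn_ge0 // exprn_ege1 //; lra.
Qed.

End DensityDichotomy.

Theorem theorem3p2 (R : realType) (k q : nat) (k_ge1 : (1 <= k)%N)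
    (q_prime_power : exists p n : nat, [/\ prime p, (0 < n)%N & q = (p ^ n)%N]) :
  exists2 C : R, 0 < C &
  forall (F : finFieldType) (cardF : #|F| = q) (N : nat) (N_gt0 : (0 < N)%N)
    (b : bohr F) (alpha : R) (A1 : {set {poly_N F}})
    (A : 'I_k -> {set {poly_N F}}),
  let B : {set {poly_N F}} := bohr_set N b in
  let alpha1 : R := density R B A1 in
  let K : R := C * alpha1 `^ (- (k%:R)^-1) in
  A1 \subset B ->
  0 < alpha1 ->
  0 < alpha < expR (- 2) ->
  (forall i : 'I_k, A i \subset B /\ alpha <= density R B (A i)) ->
  (exists b' : bohr F, let B' : {set {poly_N F}} := bohr_set N b' in
     [/\ B' \subset B,
         (rk b')%:R <= (rk b)%:R + K * ln (alpha^-1),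
         expR (- (K * ln (alpha^-1))) <= density R B B' &
         exists2 x, x \in B & 2 * alpha1 <= density R B' (translate A1 x)])
  \/
  (exists (L : {set {poly_N F}}) (S : 'I_k -> {set {poly_N F}}),
     [/\ L \subset B,
         forall i : 'I_k, S i \subset B,
         2 ^- (k + 6) <= density R B L,
         forall i : 'I_k, alpha `^ K <= density R B (S i) &
         forall x : {poly_N F},
           iter_conv R B L S x <= alpha1 ^- 2 * iter_conv R B A1 A x]).
Proof.
exists (32 * k * q + k + 2)%:R; first by rewrite ltr0n addn2.
move=> F cardF N N_gt0 b alpha A1 A B alpha1 K sA1 a1_gt0 /andP[a_gt0 a_lt] hA.
have q0 : (0 < q)%N by rewrite -cardF; apply/card_gt0P; exists 0.
have [h|h] := leP (2 ^- (k + 6)) alpha1; last first.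
  exact: (sparse_case k_ge1 sA1 a1_gt0 a_gt0 a_lt hA cardF q0 (lexx _) h).
right; apply: thick_case => //.
have := delta_ge1 k sA1 a1_gt0; set dl := _ `^ _ => h1.
have h2 : 1 <= (32 * k * q + k + 2)%:R :> R by rewrite ler1n addn2.
by rewrite /K -/dl; nra.
Qed.
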